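(* Let $\Phi$ be an irreducible crystallographic root system in $\mathbb{R}^\ell$ with $\ell\ge 2$. Then $\Phi$ is of type $G_2$ if and only if $c_{\max}=m_2-2$, where $c_{\max}$ is the largest coefficient of the highest root of $\Phi$ and $m_2$ is the second smallest exponent of the Weyl group of $\Phi$.
   Context: Root systems are reduced and span $V=\mathbb{R}^\ell$. Fix a positive system $\Phi^+$ with simple system $\Delta=\{\alpha_1,\ldots,\alpha_\ell\}$. The highest root (for the order $\beta\le\alpha$ iff $\alpha-\beta\in\sum_i\mathbb{Z}_{\ge0}\alpha_i$) is $\theta=\sum_{i=1}^\ell c_i\alpha_i$, and $c_{\max}:=\max\{c_i\mid 1\le i\le\ell\}$. The exponents $m_1\le m_2\le\cdots\le m_\ell$ of the Weyl group $W$ are the integers with $0<m_j<\mathrm{h}$ such that the eigenvalues of a Coxeter element $s_{\alpha_1}\cdots s_{\alpha_\ell}$ (of order $\mathrm{h}$) are $\exp(2\pi\sqrt{-1}\,m_j/\mathrm{h})$, $1\le j\le\ell$. *)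

(* Defs.v *)
From HB Require Import structures.
From mathcomp Require Import all_boot all_order all_algebra.
From mathcomp Require Import finmap.
From mathcomp Require Import complex.
From mathcomp Require Import reals trigo.

Set Implicit Arguments.
Unset Strict Implicit.
Unset Printing Implicit Defensive.

Import Order.TTheory GRing.Theory Num.Theory.

Local Open Scope ring_scope.

(* R^l is 'cV[R]_l with its standard inner product. Column vectors are used so
   that a product of reflection matrices is the composite, in the same order,
   of the reflections acting by v |-> A *m v. *)
Section RootSystems.

Variables (R : realType) (l : nat).
Implicit Types (a b v : 'cV[R]_l) (Phi Pos : {fset 'cV[R]_l}).
Implicit Types (alpha : 'I_l -> 'cV[R]_l).

Definition dotv (u v : 'cV[R]_l) : R := \sum_(i < l) u i 0 * v i 0.

Definition refl_mx a : 'M[R]_l := 1%:M - (2 / dotv a a) *: (a *m a^T).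

Definition cartan_int a b : R := 2 * dotv a b / dotv b b.

Definition is_root_system Phi : Prop :=
  [/\ 0 \notin Phi,
      (<<enum_fset Phi>> = fullv :> {vspace 'cV[R]_l})%VS,
      forall a b, a \in Phi -> b \in Phi -> refl_mx a *m b \in Phi &
      forall a (k : R), a \in Phi -> k *: a \in Phi -> k = 1 \/ k = -1].

Definition crystallographic Phi : Prop :=
  forall a b, a \in Phi -> b \in Phi -> cartan_int a b \is a Num.int.

Definition irreducible_roots Phi : Prop :=
  Phi <> fset0 /\
  forall A B : {fset 'cV[R]_l}, Phi = (A `|` B)%fset ->
    (forall a b, a \in A -> b \in B -> dotv a b = 0) ->
    A = fset0 \/ B = fset0.

Definition is_positive_system Phi Pos : Prop :=
  [/\ (Pos `<=` Phi)%fset,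
      forall a, a \in Phi -> (a \in Pos) (+) (- a \in Pos) &
      forall a b, a \in Pos -> b \in Pos -> a + b \in Phi -> a + b \in Pos].

Definition root_le alpha b a : Prop :=
  exists k : 'I_l -> nat, a - b = \sum_(i < l) (k i)%:R *: alpha i.

Definition is_simple_system Pos alpha : Prop :=
  [/\ basis_of fullv [seq alpha i | i <- enum 'I_l],
      forall i, alpha i \in Pos &
      forall a, a \in Pos -> root_le alpha 0 a].

Definition is_highest_root Phi alpha theta : Prop :=
  theta \in Phi /\ forall b, b \in Phi -> root_le alpha b theta.

Definition cartan_mx alpha : 'M[R]_l :=
  \matrix_(i < l, j < l) cartan_int (alpha i) (alpha j).

Definition coxeter_mx alpha : 'M[R]_l := \prod_(i < l) refl_mx (alpha i).

Definition has_order (A : 'M[R]_l) (h : nat) : Prop :=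
  [/\ (0 < h)%N, A ^+ h = 1 &
      forall k : nat, (0 < k < h)%N -> A ^+ k <> 1].

Definition expi (t : R) : R[i] := Complex (cos t) (sin t).

(* The eigenvalues are taken with multiplicity, i.e. as the roots of the
   characteristic polynomial. *)
Definition is_exponents alpha (m : l.-tuple nat) : Prop :=
  exists h : nat,
    [/\ has_order (coxeter_mx alpha) h,
        sorted leq m,
        forall j : 'I_l, (0 < tnth m j < h)%N &
        char_poly (map_mx (real_complex R) (coxeter_mx alpha)) =
          \prod_(j < l) ('X - (expi (2 * pi * (tnth m j)%:R / h%:R))%:P)].

End RootSystems.

Definition G2_cartan_mx (R : realType) : 'M[R]_2 :=
  \matrix_(i < 2, j < 2)
    if i == j then 2 else if i == 0 then - 1 else - 3.

(* The bijection f forces l = 2 and makes the condition independent of the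
   numbering of the simple roots. *)
Definition is_type_G2 (R : realType) (l : nat) (Phi : {fset 'cV[R]_l}) : Prop :=
  exists (Pos : {fset 'cV[R]_l}) (alpha : 'I_l -> 'cV[R]_l),
    [/\ is_positive_system Phi Pos, is_simple_system Pos alpha &
        exists2 f : 'I_l -> 'I_2, bijective f &
          forall i j, cartan_mx alpha i j = G2_cartan_mx R (f i) (f j)].

Definition c_max (l : nat) (c : 'I_l -> nat) : nat := \max_(i < l) c i.

(* Main.v *)
Require Import Defs.
From mathcomp Require Import all_boot all_order all_algebra.
From mathcomp Require Import finmap.
From mathcomp Require Import reals.
From mathcomp Require Import complex trigo perm zify ring lra.

Set Implicit Arguments.
Unset Strict Implicit.
Unset Printing Implicit Defensive.

Import Order.TTheory GRing.Theory Num.Theory.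

(** A longest path in the Dynkin graph misses at most one vertex, since every other configuration
    contains an affine diagram, whose null vector contradicts positive definiteness. This gives
    the list of types. If the Coxeter element is [- U^-1 V] with [U] and [V] unitriangular, its
    characteristic polynomial at [z] is [\det (z U + V)], and removing a leaf of the graph gives
    a two-term recursion for this determinant. In each type other than G2 this yields an integer
    [H] such that every eigenvalue is an [H]-th root of unity, so that the Coxeter number is at
    most [H], and an integer [k] such that [exp (2 i pi / H)] and [exp (2 i pi k / H)] are
    eigenvalues, so that the second exponent is at most [k]. The highest root is dominant and
    dominates every root, which forces a coefficient at least [k - 1]; hence [m_2 <= c_max + 1].
    In type G2 one finds [c_max = 3] and [m_2 = 5]. *)

(** * Connected graphs of finite type *)

(** Outside G2 the inequality m_2 <= c_max + 1 already contradicts c_max = m_2 - 2, so an upper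
    bound on m_2 and a lower bound on one coefficient suffice there, and neither the Coxeter number
    nor the highest root is computed. The bounds leave no slack: m_2 = c_max + 1 in each of these
    types. From m_j / h = k / H one gets m_j = k h / H, which is at most k because h <= H. That
    every eigenvalue is an H-th root of unity does not by itself make the H-th power of the Coxeter
    element trivial; its finite order takes the place of diagonalizability. Two obstacles remain.
    The Coxeter element multiplies the reflections in the order of [alpha], while leaves are removed
    in the order of the graph; this is harmless because only products of opposite entries of the
    pencil enter the recursion. And [is_type_G2] speaks of some simple system, perhaps not [alpha];
    in rank two the ratio 3 of squared root lengths, which depends on [Phi] alone, keeps G2 apart
    from the other types. *)

Section FiniteType.

Variables (T : finType) (N : T -> T -> nat).

Definition adj (s t : T) : bool := (0 < N s t)%N.
Definition mult (s t : T) : nat := (N s t * N t s)%N.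

Hypothesis Ndiag : forall x, N x x = 0%N.
Hypothesis adjC : symmetric adj.
Hypothesis N_finite : forall w : T -> nat,
  (forall t, 0 < w t -> 2 * w t <= \sum_s w s * N s t)%N -> forall t, w t = 0%N.
Hypothesis N_connected : forall J : {set T}, J != set0 -> J != setT ->
  exists s t, [/\ s \in J, t \notin J & adj s t].

Lemma multC s t : mult s t = mult t s.
Proof. by rewrite /mult mulnC. Qed.

Lemma mult_gt0 s t : (0 < mult s t)%N = adj s t.
Proof. by rewrite /mult muln_gt0 -/(adj s t) -/(adj t s) (adjC t) andbb. Qed.

(** Lists of weighted vertices allow an affine diagram to be written down directly. Unlisted
    vertices get weight 0, so only listed ones are tested, and additional edges among these only
    enlarge the right-hand sides. *)
Lemma finite_type_seq (z : seq (T * nat)) : uniq (unzip1 z) ->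
  (forall p, p \in z -> 2 * p.2 <= \sum_(r <- z) r.2 * N r.1 p.1)%N ->
  forall p, p \in z -> p.2 = 0%N.
Proof.
move=> uz hz.
pose w t := (\sum_(r <- z | r.1 == t) r.2)%N.
have wE p : p \in z -> w p.1 = p.2.
  rewrite /w => pz; elim: z uz pz {hz w} => //= q z IH /andP[qz uz].
  rewrite inE big_cons => /predU1P[->|pz].
    rewrite eqxx big_seq_cond big1 ?addn0 // => r /andP[rz /eqP E].
    by case/negP: qz; rewrite -E; apply: map_f.
  case: eqP => [E|_]; last exact: IH.
  by case/negP: qz; rewrite E; apply: map_f.
have wS t : (\sum_s w s * N s t = \sum_(r <- z) r.2 * N r.1 t)%N.
  rewrite [RHS](partition_big (fun r : T * nat => r.1) xpredT) //=.
  by apply: eq_bigr => s _; rewrite /w big_distrl /=; apply: eq_bigr => r /eqP ->.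
have w0 t : (0 < w t)%N -> exists2 p, p \in z & p.1 = t.
  rewrite /w lt0n; case E: (has (fun p => p.1 == t) z).
    by move=> _; case/hasP: E => p pz /eqP; exists p.
  rewrite big_hasC ?E //.
have w00 : forall t, w t = 0%N.
  apply: N_finite => t wt; case: (w0 t wt) => p pz pt.
  by rewrite wS -pt wE //; apply: hz.
by move=> p pz; rewrite -wE.
Qed.

Lemma le_big_seq (q : seq T) (F : T -> nat) y : y \in q -> (F y <= \sum_(x <- q) F x)%N.
Proof. by move=> yq; rewrite (big_rem y yq) /= leq_addr. Qed.

(** Put weight 2 on the centre and [N x v] on each neighbour: [v] receives at least [2 * N x v] from
    the centre, and the centre receives the sum of the multiplicities, which must therefore stay
    below 2 * 2. *)
Lemma no_star x (G : seq T) : uniq (x :: G) -> (\sum_(v <- G) mult x v < 4)%N.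
Proof.
move=> ux; rewrite ltnNge; apply/negP => h.
have := @finite_type_seq ((x, 2) :: [seq (v, N x v) | v <- G]).
have -> : unzip1 ((x, 2) :: [seq (v, N x v) | v <- G]) = x :: G.
  by rewrite /= /unzip1 -map_comp map_id.
move=> /(_ ux) H; suff: (2 = 0)%N by [].
apply: (H _ (x, 2)); last by rewrite inE eqxx.
move=> p; rewrite inE big_cons big_map /= => /predU1P[->|/mapP[v vG ->]] /=.
  by rewrite Ndiag muln0 add0n.
exact: leq_addr.
Qed.

(** Constant weight 1 is the null vector of affine A: every vertex of a cycle of length at least 3
    has two distinct neighbours on it. *)
Lemma no_cycle (q : seq T) : uniq q -> (2 < size q)%N -> cycle adj q = false.
Proof.
move=> uq sq; apply/negP => cq.
have := @finite_type_seq [seq (v, 1%N) | v <- q].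
have -> : unzip1 [seq (v, 1%N) | v <- q] = q by rewrite /unzip1 -map_comp map_id.
move=> /(_ uq) H; suff: (1 = 0)%N by [].
have [x xq] : exists x, x \in q by case: (q) sq => // x ? _; exists x; rewrite inE eqxx.
apply: (H _ (x, 1%N)) (map_f _ xq) => p /mapP[{xq}y yq ->] /=.
rewrite big_map /=.
(* After rotation [y] comes first, and its two neighbours are the second and the last entry. *)
case/rot_to: yq => k q' E.
rewrite (perm_big (rot k q)) /=; last by rewrite perm_sym perm_rot.
have := uq; have := cq; have := sq.
rewrite -(rot_uniq k) -(rot_cycle k) -(size_rot k q) E big_cons Ndiag.
case: q' {E} => [|a q'] //; case: (lastP q') => // {}q' b _ /=.
rewrite rcons_path last_rcons => /andP[ya /andP[_ bh]] /andP[_ /andP[+ _]].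
rewrite big_cons -cats1 big_cat /= big_cons => _.
move: ya bh; rewrite adjC /adj; lia.
Qed.

(* The weights are those of the null vector of the affine diagrams of types B, C and D. *)
Lemma no_chain x (q GL GR : seq T) : uniq ((x :: q) ++ GL ++ GR) -> path adj x q ->
  (1 < \sum_(v <- GL) mult x v)%N -> (1 < \sum_(v <- GR) mult (last x q) v)%N -> False.
Proof.
move=> uq pq; rewrite /mult => hL hR.
pose z := [seq (v, 2%N) | v <- x :: q] ++ [seq (v, N x v) | v <- GL] ++
          [seq (v, N (last x q) v) | v <- GR].
have uz : uniq (unzip1 z).
  rewrite /unzip1 !map_cat -!map_comp.
  by rewrite [map _ (x :: q)]map_id !(@eq_map _ _ (_ \o _) id) ?map_id.
suff: (2 = 0)%N by [].
apply: (finite_type_seq uz _ (p := (x, 2))); last first.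
  by rewrite mem_cat; apply/orP; left; apply: map_f; rewrite inE eqxx.
move=> p; rewrite {2}/z !big_cat !big_map /=.
rewrite mem_cat => /orP[/mapP[y yq ->]|].
  have [q1 [q2 E]] : exists q1 q2, x :: q = q1 ++ y :: q2.
    by case/splitPr: yq => q1 q2; exists q1, q2.
  rewrite E big_cat /= big_cons Ndiag muln0 add0n.
  have h1 : (1 < \sum_(i <- q1) 2 * N i y + \sum_(v <- GL) N x v * N v y)%N.
    case: q1 E => [|a q1 [xa]] /= E; first by case: E hL => -> _; lia.
    subst a.
    suff: (2 <= \sum_(i <- x :: q1) 2 * N i y)%N by move=> *; lia.
    have [b bq] : exists2 b, b \in x :: q1 & adj b y.
      exists (last x q1); first exact: mem_last.
      by move: pq; rewrite E cat_path /= => /and3P[].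
    by have := le_big_seq (fun i => 2 * N i y)%N bq; rewrite /adj; lia.
  have h2 : (1 < \sum_(i <- q2) 2 * N i y + \sum_(v <- GR) N (last x q) v * N v y)%N.
    have : last x q = last y q2 by move: (congr1 (last x) E); rewrite /= last_cat.
    case: q2 E => [|a q2] /= E Elast; first by rewrite -Elast big_nil; lia.
    have : adj a y.
      case: q1 E {h1} => [|? q1] /= [xy E].
        by move: pq; rewrite E xy /= adjC => /andP[].
      by move: pq; rewrite E cat_path /= => /and4P[_ _ + _]; rewrite adjC.
    by rewrite big_cons /adj; lia.
  by rewrite addnACA; exact: leq_add h1 h2.
rewrite mem_cat => /orP[] /mapP[y yG ->] /=.
  have := @le_big_seq (x :: q) (fun i => 2 * N i y)%N x; rewrite inE eqxx /= => /(_ isT).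
  by lia.
have := @le_big_seq (x :: q) (fun i => 2 * N i y)%N (last x q) (mem_last _ _) => /=.
by lia.
Qed.

Lemma longest_path (x0 : T) : exists s : seq T,
  [/\ uniq s, sorted adj s, (0 < size s)%N &
      forall s', uniq s' -> sorted adj s' -> (size s' <= size s)%N].
Proof.
pose P k := [exists t : k.-tuple T, uniq t && sorted adj t].
have P1 : P 1%N by apply/existsP; exists [tuple x0].
have Pb k : P k -> (k <= #|T|)%N.
  case/existsP => t /andP[ut _]; rewrite -{1}(size_tuple t) -(card_uniqP ut).
  exact: max_card.
case: (ex_maxnP (ex_intro _ 1%N P1) Pb) => k /existsP[t /andP[ut st]] kmax.
exists t; split=> //; first by rewrite size_tuple kmax.
move=> s us ss; rewrite size_tuple; apply: kmax; apply/existsP.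
by exists (in_tuple s); rewrite us.
Qed.

(** The path is a function on all of [nat], of which only the values below [n] matter; subpaths and
    reversal are then arithmetic on indices. *)
Definition induced_path (n : nat) (x : nat -> T) : Prop :=
  [/\ forall i j, (i < n)%N -> (j < n)%N -> x i = x j -> i = j,
      forall i, (i.+1 < n)%N -> adj (x i) (x i.+1) &
      forall i j, (i.+1 < j < n)%N -> adj (x i) (x j) = false].

Lemma induced_path_rev n x : induced_path n x -> induced_path n (fun i => x (n.-1 - i)%N).
Proof.
case=> inj edge chord; split.
- by move=> i j ? ? /inj; lia.
- move=> i ?; rewrite adjC; have -> : (n.-1 - i = (n.-1 - i.+1).+1)%N by lia.
  by apply: edge; lia.
- by move=> i j ?; rewrite adjC; apply: chord; lia.
Qed.

Lemma path_map_iota (x : nat -> T) i k :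
  (forall a, (i <= a < i + k)%N -> adj (x a) (x a.+1)) ->
  path adj (x i) (map x (iota i.+1 k)).
Proof.
elim: k i => //= k IH i h; rewrite h ?leqnn ?IH //; last lia.
by move=> a ?; apply: h; lia.
Qed.

Lemma last_map_iota (x : nat -> T) i k : last (x i) (map x (iota i.+1 k)) = x (i + k)%N.
Proof. by elim: k i => [|k IH] i /=; rewrite ?addn0 // IH addSnnS. Qed.

(** * Edge multiplicities along an induced path *)

Section InducedPath.

Variables (n : nat) (x : nat -> T).
Hypothesis Px : induced_path n x.

Lemma uniq_map_path (s : seq nat) : uniq s -> (forall i, i \in s -> i < n)%N ->
  uniq (map x s).
Proof.
by case: Px => inj _ _ us sn; rewrite map_inj_in_uniq // => i j /sn ? /sn ? /inj; exact.
Qed.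

Lemma no_path_chain i k GL GR : (i + k < n)%N -> uniq (map x (iota i k.+1) ++ GL ++ GR) ->
  (1 < \sum_(v <- GL) mult (x i) v)%N -> (1 < \sum_(v <- GR) mult (x (i + k)%N) v)%N -> False.
Proof.
move=> ikn ug hL hR; apply: (no_chain ug) hL _; last by rewrite last_map_iota.
by apply: path_map_iota => a ?; case: Px => _ edge _; apply: edge; lia.
Qed.

Lemma mult_path i : (i.+1 < n)%N -> (0 < mult (x i) (x i.+1))%N.
Proof. by case: Px => _ edge _ ?; rewrite mult_gt0; apply: edge. Qed.

(** Two multiple edges on a path are the ends of a forbidden chain, each end group being a single
    vertex. *)
Lemma mult_path_le1 i j : (i < j)%N -> (j.+1 < n)%N ->
  (1 < mult (x i) (x i.+1))%N -> mult (x j) (x j.+1) = 1%N.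
Proof.
move=> ij jn hi; apply/eqP; rewrite eqn_leq mult_path // andbT leqNgt; apply/negP => hj.
apply: (@no_path_chain i.+1 (j - i.+1) [:: x i] [:: x j.+1]).
- by lia.
- rewrite -(map_cat x _ [:: i; j.+1]); apply: uniq_map_path.
    by rewrite uniq_catC !cat_cons !cons_uniq iota_uniq !inE !mem_iota; lia.
  by move=> a; rewrite mem_cat mem_iota !inE; lia.
- by rewrite big_seq1 multC.
- by rewrite big_seq1 subnKC.
Qed.

Lemma mult_path_lt4 i : (i.+1 < n)%N -> (mult (x i) (x i.+1) < 4)%N.
Proof.
move=> ?; have := @no_star (x i) [:: x i.+1]; rewrite big_seq1; apply.
by apply: (@uniq_map_path [:: i; i.+1]) => [|a]; rewrite /= !inE; lia.
Qed.

(** A triple edge with one further edge at an endpoint is a star of total multiplicity at least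
    4. *)
Lemma mult_path_lt3 i : (i.+1 < n)%N -> (2 < n)%N -> (mult (x i) (x i.+1) < 3)%N.
Proof.
move=> ? ?; case: (posnP i) => [->|i0].
  have := @no_star (x 1) [:: x 0; x 2]; rewrite !big_cons big_nil (multC _ (x 0)).
  have : (0 < mult (x 1) (x 2))%N by apply: mult_path.
  suff -> : uniq [:: x 1; x 0; x 2] by lia.
  by apply: (@uniq_map_path [:: 1; 0; 2]) => [|a]; rewrite /= ?inE; lia.
have := @no_star (x i) [:: x i.-1; x i.+1]; rewrite !big_cons big_nil (multC _ (x i.-1)).
have : (0 < mult (x i.-1) (x i))%N by rewrite -{2}(prednK i0); apply: mult_path; lia.
suff -> : uniq [:: x i; x i.-1; x i.+1] by lia.
by apply: (@uniq_map_path [:: i; i.-1; i.+1]) => [|a]; rewrite /= ?inE; lia.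
Qed.

(** Five consecutive vertices form affine F4 or its dual. The direction of the double edge decides
    which null vector applies: 2, 4, 3, 2, 1 or 1, 2, 3, 2, 1. *)
Lemma no_F4_affine i : (0 < i)%N -> (i.+3 < n)%N -> mult (x i) (x i.+1) = 2 -> False.
Proof.
move=> i0 i3 m2.
have m1 : mult (x i.-1) (x i) = 1%N.
  have ? : (0 < mult (x i.-1) (x i))%N by rewrite -{2}(prednK i0); apply: mult_path; lia.
  apply/eqP; rewrite eqn_leq andbC; apply/andP; split=> //; rewrite leqNgt; apply/negP => h.
  by have := @mult_path_le1 i.-1 i; rewrite prednK // h m2; lia.
have m3 : mult (x i.+1) (x i.+2) = 1%N by apply: (mult_path_le1 (i := i)); lia.
have m4 : mult (x i.+2) (x i.+3) = 1%N by apply: (mult_path_le1 (i := i)); lia.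
have u : uniq (map x [:: i.-1; i; i.+1; i.+2; i.+3]).
  by apply: uniq_map_path => [|a]; rewrite /= ?inE; lia.
have mult1 a b : mult a b = 1%N -> N a b = 1%N /\ N b a = 1%N.
  by move/eqP; rewrite muln_eq1 => /andP[/eqP-> /eqP->].
have [n1 n1'] := mult1 _ _ m1; have [n3 n3'] := mult1 _ _ m3.
have [n4 n4'] := mult1 _ _ m4; move: m2; rewrite /mult => m2.
have [[h h']|[h h']] : (N (x i) (x i.+1) = 1 /\ N (x i.+1) (x i) = 2 \/
        N (x i) (x i.+1) = 2 /\ N (x i.+1) (x i) = 1)%N.
- by case: (N (x i) _) m2 => [|[|[|a]]]; lia.
- have := @finite_type_seq (zip (map x [:: i.-1; i; i.+1; i.+2; i.+3]) [:: 2; 4; 3; 2; 1]).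
  rewrite unzip1_zip // u => /(_ isT) /= H.
  suff: (4 = 0)%N by []; apply: (H _ (x i, 4)); last by rewrite !inE eqxx ?orbT.
  by move=> p; rewrite !inE !big_cons big_nil => /or4P[|||/orP[|]] /eqP -> /=; rewrite ?Ndiag; lia.
- have := @finite_type_seq (zip (map x [:: i.-1; i; i.+1; i.+2; i.+3]) [:: 1; 2; 3; 2; 1]).
  rewrite unzip1_zip // u => /(_ isT) /= H.
  suff: (2 = 0)%N by []; apply: (H _ (x i, 2)); last by rewrite !inE eqxx ?orbT.
  by move=> p; rewrite !inE !big_cons big_nil => /or4P[|||/orP[|]] /eqP -> /=; rewrite ?Ndiag; lia.
Qed.

End InducedPath.
(** Maximality is among all simple paths, induced or not, so that a competing path needs no check of
    its chords. *)
Definition longest_induced_path (n : nat) (x : nat -> T) : Prop :=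
  [/\ induced_path n x, (0 < n)%N &
      forall s, uniq s -> sorted adj s -> (size s <= n)%N].

Definition off_path n (x : nat -> T) v := forall i, (i < n)%N -> v != x i.

(** A chord would close a cycle of length at least 3. *)
Lemma longest_path_induced (x0 : T) : exists n x, longest_induced_path n x.
Proof.
case: (longest_path x0) => s [us ss s0 smax].
exists (size s), (nth x0 s); split=> //.
have inj i j : (i < size s)%N -> (j < size s)%N -> nth x0 s i = nth x0 s j -> i = j.
  by move=> ? ? /eqP; rewrite nth_uniq // => /eqP.
have edge : forall i, (i.+1 < size s)%N -> adj (nth x0 s i) (nth x0 s i.+1).
  by apply/sortedP.
split=> // i j ij; rewrite adjC; apply/negP => ji.
have := @no_cycle (map (nth x0 s) (iota i (j - i).+1)).
rewrite size_map size_iota map_inj_in_uniq ?iota_uniq; last first.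
  by move=> a b; rewrite !mem_iota => ? ? /inj; apply; lia.
have ij2 : (2 < (j - i).+1)%N by lia.
move=> /(_ isT ij2); rewrite [cycle _ _]/= rcons_path last_map_iota.
rewrite subnKC ?ji ?path_map_iota //; last by lia.
by move=> a ?; apply: edge; lia.
Qed.

Lemma longest_induced_path_rev n x :
  longest_induced_path n x -> longest_induced_path n (fun i => x (n.-1 - i)%N).
Proof. by case=> Px n0 nmax; split=> //; apply: induced_path_rev. Qed.

Lemma off_path_rev n x v : off_path n x v -> off_path n (fun i => x (n.-1 - i)%N) v.
Proof. by move=> vx i ?; apply: vx; lia. Qed.

(** * Vertices attached to a longest path *)

Section Branch.

Variables (n : nat) (x : nat -> T).
Hypothesis Lx : longest_induced_path n x.
Let Px : induced_path n x. Proof. by case: Lx. Qed.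

Lemma uniq_off_path (s : seq nat) (q : seq T) : uniq s -> (forall i, i \in s -> i < n)%N ->
  uniq q -> (forall v, v \in q -> off_path n x v) -> uniq (map x s ++ q).
Proof.
move=> us sn uq qx; rewrite cat_uniq (uniq_map_path Px) // uq andbT /=.
by apply/hasPn => v vq; apply/mapP => -[i /sn ?]; apply/eqP/qx.
Qed.

Lemma uniq_off_path_drop i (s : seq T) : uniq s -> (forall v, v \in s -> off_path n x v) ->
  (i < n)%N -> uniq (s ++ map x (iota i (n - i.+1).+1)).
Proof.
move=> us sx ?; rewrite uniq_catC; apply: uniq_off_path => //; first exact: iota_uniq.
by move=> a; rewrite mem_iota; lia.
Qed.

Lemma path_drop i : (i < n)%N -> path adj (x i) (map x (iota i.+1 (n - i.+1))).
Proof.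
by move=> ?; apply: path_map_iota => k ?; case: Px => _ edge _; apply: edge; lia.
Qed.

(** The path [v], [x i], and so on to the end has n - i + 1 vertices, which maximality bounds by
    [n]. Prepending one more vertex [w] gives [branch_gt1]. *)
Lemma branch_gt0 v i : off_path n x v -> (i < n)%N -> adj v (x i) -> (0 < i)%N.
Proof.
case: Lx => _ _ nmax vx ? vi.
have := nmax ([:: v] ++ map x (iota i (n - i.+1).+1)).
rewrite uniq_off_path_drop // => [/(_ isT)|a]; last by rewrite inE => /eqP ->.
by rewrite /= vi path_drop // size_map size_iota => /(_ isT); lia.
Qed.

Lemma branch_gt1 v w i : off_path n x v -> off_path n x w -> v != w ->
  (i < n)%N -> adj v (x i) -> adj w v -> (1 < i)%N.
Proof.
case: Lx => _ _ nmax vx wx vw ? vi wv.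
have := nmax ([:: w; v] ++ map x (iota i (n - i.+1).+1)).
rewrite uniq_off_path_drop //; first last.
- by move=> a; rewrite !inE => /orP[] /eqP ->.
- by rewrite /= inE eq_sym vw.
by rewrite /= wv vi path_drop // size_map size_iota => /(_ isT isT); lia.
Qed.

End Branch.

Lemma branch_gt0_rev n x v i : longest_induced_path n x -> off_path n x v ->
  (i < n)%N -> adj v (x i) -> (i.+1 < n)%N.
Proof.
move=> Lx vx ? vi; suff: (0 < n.-1 - i)%N by lia.
apply: (branch_gt0 (longest_induced_path_rev Lx) (off_path_rev vx)); first by lia.
by rewrite subKn //; lia.
Qed.

Lemma branch_gt1_rev n x v w i : longest_induced_path n x ->
  off_path n x v -> off_path n x w -> v != w ->
  (i < n)%N -> adj v (x i) -> adj w v -> (i.+2 < n)%N.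
Proof.
move=> Lx vx wx vw ? vi wv; suff: (1 < n.-1 - i)%N by lia.
apply: (branch_gt1 (longest_induced_path_rev Lx) (off_path_rev vx) (off_path_rev wx) vw);
  rewrite ?subKn //; lia.
Qed.
(** The chain from [x i] to [x j], with a path neighbour and a branch at each end, is affine D; for
    [i = j] it degenerates to a star with four edges. *)
Lemma no_two_branches n x v w i j : longest_induced_path n x ->
  off_path n x v -> off_path n x w -> v != w -> (i <= j < n)%N ->
  adj v (x i) -> adj w (x j) -> False.
Proof.
move=> Lx vx wx vw /andP[ij jn] vi wj; have [Px _ _] := Lx; have [_ edge _] := Px.
have i0 := branch_gt0 Lx vx (leq_ltn_trans ij jn) vi.
have j1 := branch_gt0_rev Lx wx jn wj.
apply: (@no_path_chain _ _ Px i (j - i) [:: x i.-1; v] [:: x j.+1; w]); first by lia.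
- rewrite (perm_uniq (_ : perm_eq _ (map x ([:: i.-1; j.+1] ++ iota i (j - i).+1) ++ [:: v; w]))).
    apply: (uniq_off_path Lx).
    + by rewrite cat_cons !cons_uniq !inE !mem_iota iota_uniq; lia.
    + by move=> a; rewrite mem_cat mem_iota !inE; lia.
    + by rewrite /= inE vw.
    + by move=> u; rewrite !inE => /orP[] /eqP ->.
  apply/seq.permP => p; rewrite map_cat !count_cat /=; lia.
- have m1 : (0 < mult (x i) v)%N by rewrite mult_gt0 adjC.
  have m2 : (0 < mult (x i) (x i.-1))%N.
    by rewrite mult_gt0 adjC -{2}(prednK i0) edge ?prednK //; lia.
  by rewrite !big_cons big_nil; lia.
- have m1 : (0 < mult (x j) w)%N by rewrite mult_gt0 adjC.
  have m2 : (0 < mult (x j) (x j.+1))%N by rewrite mult_gt0 edge.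
  by rewrite subnKC // !big_cons big_nil; lia.
Qed.

Lemma no_two_neighbours n x v i j : longest_induced_path n x -> off_path n x v ->
  (i < j < n)%N -> adj v (x i) -> adj v (x j) -> False.
Proof.
move=> Lx vx /andP[ij jn] vi vj; have [[_ edge _] _ _] := Lx.
have := @no_cycle (v :: map x (iota i (j - i).+1)).
rewrite -cat1s uniq_catC (uniq_off_path Lx) ?iota_uniq //; first last.
- by move=> a; rewrite inE => /eqP ->.
- by move=> a; rewrite mem_iota; lia.
have s2 : (2 < size ([:: v] ++ map x (iota i (j - i).+1)))%N.
  by rewrite size_cat size_map size_iota /=; lia.
move=> /(_ isT s2); rewrite [cycle _ _]/= rcons_path last_map_iota subnKC; last exact: ltnW.
by rewrite vi adjC vj path_map_iota // => a ?; apply: edge; lia.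
Qed.

Section BranchVertex.

Variables (n : nat) (x : nat -> T) (v : T) (i : nat).
Hypotheses (Lx : longest_induced_path n x) (vx : off_path n x v).
Hypotheses (ni : (i < n)%N) (vi : adj v (x i)).

Let Px : induced_path n x. Proof. by case: Lx. Qed.
Let edge j : (j.+1 < n)%N -> adj (x j) (x j.+1). Proof. by case: Px => _ + _; exact. Qed.
Let i0 : (0 < i)%N. Proof. exact: (branch_gt0 Lx vx ni vi). Qed.
Let i1 : (i.+1 < n)%N. Proof. exact: (branch_gt0_rev Lx vx ni vi). Qed.
Let mv : (0 < mult (x i) v)%N. Proof. by rewrite mult_gt0 adjC. Qed.
Let mp : (0 < mult (x i) (x i.-1))%N.
Proof. by rewrite mult_gt0 adjC -{2}(prednK i0) edge ?prednK // ltnW. Qed.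
Let ms : (0 < mult (x i) (x i.+1))%N. Proof. by rewrite mult_gt0 edge. Qed.

Let N_edge j : (j.+1 < n)%N -> (0 < N (x j) (x j.+1))%N && (0 < N (x j.+1) (x j))%N.
Proof. by move=> ?; rewrite -!/(adj _ _) [adj (x j.+1) _]adjC edge. Qed.

Let N_branch : (0 < N v (x i))%N && (0 < N (x i) v)%N.
Proof. by rewrite -!/(adj _ _) [adj (x i) _]adjC vi. Qed.

Lemma branch_adj j : (j < n)%N -> adj v (x j) = (j == i).
Proof.
move=> jn; apply/idP/eqP => [vj|->//].
by case: (ltngtP i j) => // ij; [case: (no_two_neighbours Lx vx (j := j) (i := i))
  | case: (no_two_neighbours Lx vx (j := i) (i := j))]; rewrite ?ij.
Qed.

Lemma mult_branch : mult v (x i) = 1%N.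
Proof.
have := @no_star (x i) [:: v; x i.-1; x i.+1]; rewrite !big_cons big_nil.
rewrite (_ : uniq _ = true); last first.
  rewrite (perm_uniq (_ : perm_eq _ (map x [:: i; i.-1; i.+1] ++ [:: v]))).
    apply: (uniq_off_path Lx) => //.
    - by rewrite /= !inE; lia.
    - by move=> a; rewrite !inE; lia.
    - by move=> a; rewrite inE => /eqP ->.
  by apply/seq.permP => p /=; lia.
by move/(_ isT); rewrite [mult v _]multC; lia.
Qed.

(** A branching at one end and a multiple edge at the other form a forbidden chain; the two cases
    are the two sides of the branch vertex. *)
Lemma mult_path_branch k : (k.+1 < n)%N -> mult (x k) (x k.+1) = 1%N.
Proof.
move=> kn; apply/eqP; rewrite eqn_leq mult_gt0 edge // andbT leqNgt; apply/negP => m2.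
case: (ltnP k i) => ki.
  apply: (@no_path_chain _ _ Px k.+1 (i - k.+1) [:: x k] [:: x i.+1; v]); first by lia.
  - rewrite (perm_uniq (_ : perm_eq _ (map x ([:: k; i.+1] ++ iota k.+1 (i - k.+1).+1) ++ [:: v]))).
      apply: (uniq_off_path Lx) => //.
      + by rewrite cat_cons !cons_uniq !inE !mem_iota iota_uniq; lia.
      + by move=> a; rewrite mem_cat mem_iota !inE; lia.
      + by move=> a; rewrite inE => /eqP ->.
    by apply/seq.permP => p; rewrite map_cat !count_cat /=; lia.
  - by rewrite big_seq1 multC.
  - by rewrite !big_cons big_nil subnKC //; lia.
apply: (@no_path_chain _ _ Px i (k - i) [:: x i.-1; v] [:: x k.+1]); first by lia.
- rewrite (perm_uniq (_ : perm_eq _ (map x ([:: i.-1; k.+1] ++ iota i (k - i).+1) ++ [:: v]))).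
    apply: (uniq_off_path Lx) => //.
    + by rewrite cat_cons !cons_uniq !inE !mem_iota iota_uniq; lia.
    + by move=> a; rewrite mem_cat mem_iota !inE; lia.
    + by move=> a; rewrite inE => /eqP ->.
  by apply/seq.permP => p; rewrite map_cat !count_cat /=; lia.
- by rewrite !big_cons big_nil; lia.
- by rewrite big_seq1 subnKC.
Qed.

Let branch_uniq (s : seq nat) : uniq s -> (forall i, i \in s -> i < n)%N ->
  uniq (map x s ++ [:: v]).
Proof.
by move=> us sn; apply: (uniq_off_path Lx) => // a; rewrite inE => /eqP ->.
Qed.

(** Maximality makes both arms of the path at [x i] at least as long as the arm [v], [w], so three
    arms of length 2 meet there. *)
Lemma no_E6_affine w : off_path n x w -> v != w -> adj w v -> False.
Proof.
move=> wx vw wv.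
have i2 := branch_gt1 Lx vx wx vw ni vi wv; have i3 := branch_gt1_rev Lx vx wx vw ni vi wv.
have u : uniq (map x [:: i.-2; i.-1; i; i.+1; i.+2] ++ [:: v; w]).
  apply: (uniq_off_path Lx) => [|a||a]; rewrite /= ?inE ?vw //; try lia.
  by case/orP => /eqP ->.
have := @finite_type_seq (zip (map x [:: i.-2; i.-1; i; i.+1; i.+2] ++ [:: v; w])
  [:: 1; 2; 3; 2; 1; 2; 1]).
rewrite unzip1_zip // u => /(_ isT) /= H.
suff: (3 = 0)%N by []; apply: (H _ (x i, 3)); last by rewrite !inE eqxx ?orbT.
have e1 : (0 < N (x i.-2) (x i.-1))%N && (0 < N (x i.-1) (x i.-2))%N.
  by have := @N_edge i.-2; rewrite (_ : i.-2.+1 = i.-1); [apply|]; lia.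
have e2 : (0 < N (x i.-1) (x i))%N && (0 < N (x i) (x i.-1))%N.
  by have := @N_edge i.-1; rewrite prednK //; apply; lia.
have e3 := @N_edge i i1; have e4 := @N_edge i.+1 i3; have e5 := N_branch.
have e6 : (0 < N w v)%N && (0 < N v w)%N.
  by rewrite -!/(adj _ _) [adj v w]adjC wv.
move=> p; rewrite !inE !big_cons big_nil.
by do ?[case/predU1P => [->|] | move/eqP => ->]; rewrite /= ?Ndiag; lia.
Qed.

Lemma no_E7_affine : (2 < i)%N -> (i.+3 < n)%N -> False.
Proof.
move=> i3 i4.
have u : uniq (map x [:: i.-1.-2; i.-2; i.-1; i; i.+1; i.+2; i.+3] ++ [:: v]).
  by apply: branch_uniq => [|a]; rewrite /= ?inE; lia.
have := @finite_type_seq (zip (map x [:: i.-1.-2; i.-2; i.-1; i; i.+1; i.+2; i.+3] ++ [:: v])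
  [:: 1; 2; 3; 4; 3; 2; 1; 2]).
rewrite unzip1_zip // u => /(_ isT) /= H.
suff: (4 = 0)%N by []; apply: (H _ (x i, 4)); last by rewrite !inE eqxx ?orbT.
have e0 : (0 < N (x i.-1.-2) (x i.-2))%N && (0 < N (x i.-2) (x i.-1.-2))%N.
  by have := @N_edge i.-1.-2; rewrite (_ : i.-1.-2.+1 = i.-2); [apply|]; lia.
have e1 : (0 < N (x i.-2) (x i.-1))%N && (0 < N (x i.-1) (x i.-2))%N.
  by have := @N_edge i.-2; rewrite (_ : i.-2.+1 = i.-1); [apply|]; lia.
have e2 : (0 < N (x i.-1) (x i))%N && (0 < N (x i) (x i.-1))%N.
  by have := @N_edge i.-1; rewrite prednK //; apply; lia.
have e3 := @N_edge i i1; have e4 := @N_edge i.+1 (ltnW i4).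
have e5 := @N_edge i.+2 i4; have e6 := N_branch.
move=> p; rewrite !inE !big_cons big_nil.
by do ?[case/predU1P => [->|] | move/eqP => ->]; rewrite /= ?Ndiag; lia.
Qed.

Lemma no_E8_affine : i = 2 -> (7 < n)%N -> False.
Proof.
move=> i2 n7.
have u : uniq (map x [:: 0; 1; 2; 3; 4; 5; 6; 7] ++ [:: v]).
  by apply: branch_uniq => [|a]; rewrite /= ?inE; lia.
have := @finite_type_seq (zip (map x [:: 0; 1; 2; 3; 4; 5; 6; 7] ++ [:: v])
  [:: 2; 4; 6; 5; 4; 3; 2; 1; 3]).
rewrite unzip1_zip // u => /(_ isT) /= H.
suff: (6 = 0)%N by []; apply: (H _ (x 2, 6)); last by rewrite !inE eqxx ?orbT.
have e j : (j < 7)%N -> (0 < N (x j) (x j.+1))%N && (0 < N (x j.+1) (x j))%N.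
  by move=> ?; apply: N_edge; lia.
have := (e 0, e 1, e 2, e 3, e 4, e 5, e 6)%N.
case=> [[[[[[/(_ isT) e0 /(_ isT) e1] /(_ isT) e2] /(_ isT) e3] /(_ isT) e4]
  /(_ isT) e5] /(_ isT) e6].
have e7 := N_branch; rewrite i2 in e7.
move=> p; rewrite !inE !big_cons big_nil.
by do ?[case/predU1P => [->|] | move/eqP => ->]; rewrite /= ?Ndiag; lia.
Qed.

(** Were there another vertex, connectedness would give an edge leaving the path together with [v].
    Starting at [v] it produces affine E6, starting on the path a second branch. *)
Lemma branch_cover w : off_path n x w -> w = v.
Proof.
move=> wx; apply/eqP/negP => /negP wv.
pose J := [set t | (t == v) || (t \in map x (iota 0 n))].
have J0 : J != set0 by apply/set0Pn; exists v; rewrite inE eqxx.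
have JT : J != setT.
  apply/negP => /eqP /setP /(_ w); rewrite !inE (negbTE wv) /= => /mapP[j].
  by rewrite mem_iota => /wx /eqP.
case: (N_connected J0 JT) => s [t [sJ tJ st]].
have {tJ} [tv tx] : t != v /\ off_path n x t.
  move: tJ; rewrite inE negb_or => /andP[-> tx]; split=> // j jn.
  by apply: contraNneq tx => ->; apply: map_f; rewrite mem_iota.
move: sJ; rewrite inE => /orP[/eqP sv|/mapP[j]].
  by apply: (no_E6_affine tx); [rewrite eq_sym|rewrite adjC -sv].
rewrite mem_iota add0n => jn sj; subst s; rewrite adjC in st.
case: (leqP i j) => ij.
  by apply: (no_two_branches Lx vx tx _ _ vi st); rewrite ?ij // eq_sym.
by apply: (no_two_branches Lx tx vx tv _ st vi); rewrite ltnW.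
Qed.

End BranchVertex.
Definition covers n (x : nat -> T) := forall t, exists2 i, (i < n)%N & t = x i.

(** The path shapes are A, G2, B or C, and F4; a branch at index 1 is D, and at index 2 it is E6,
    E7, E8 for [n] equal to 5, 6, 7. The direction of multiple edges is left open, since [mult] is
    symmetric. *)
Inductive finite_shape : Prop :=
| PathShape n x of induced_path n x & covers n x & (1 < n)%N &
    let m i := mult (x i) (x i.+1) in
    [\/ forall i, (i.+1 < n)%N -> m i = 1%N,
        n = 2 /\ m 0 = 3,
        m 0 = 2 /\ (forall i, (0 < i)%N -> (i.+1 < n)%N -> m i = 1%N) |
        n = 4 /\ [/\ m 0 = 1, m 1 = 2 & m 2 = 1]%N]
| BranchShape n x v i of induced_path n x & off_path n x v &
    (forall t, t != v -> exists2 j, (j < n)%N & t = x j) &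
    (forall j, (j < n)%N -> adj v (x j) = (j == i)) & mult v (x i) = 1%N &
    (forall k, (k.+1 < n)%N -> mult (x k) (x k.+1) = 1%N) &
    (i.+1 < n)%N & i = 1 \/ i = 2 /\ (4 < n < 8)%N.

Lemma card_covers n x : induced_path n x -> covers n x -> #|T| = n.
Proof.
move=> Px cx; have us : uniq (map x (iota 0 n)).
  by apply: (uniq_map_path Px) => [|i]; rewrite ?iota_uniq ?mem_iota.
rewrite -[RHS](size_iota 0 n) -(size_map x) -(card_uniqP us).
apply: eq_card => t; rewrite inE; apply/esym/mapP; case: (cx t) => i ? ->.
by exists i; rewrite // mem_iota.
Qed.

Lemma card_branch n x v : induced_path n x -> off_path n x v ->
  (forall t, t != v -> exists2 j, (j < n)%N & t = x j) -> #|T| = n.+1.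
Proof.
move=> Px vx cx.
have u : uniq (v :: map x (iota 0 n)).
  rewrite cons_uniq (uniq_map_path Px) ?iota_uniq //; last by move=> i; rewrite mem_iota.
  by rewrite andbT; apply/mapP => -[k]; rewrite mem_iota => /vx /eqP.
rewrite -[in RHS](size_iota 0 n) -(size_map x) -[RHS]/(size (v :: _)) -(card_uniqP u).
apply: eq_card => t; rewrite !inE; apply/esym; case: eqVneq => //= /cx[i ? ->].
by apply: map_f; rewrite mem_iota.
Qed.

Lemma path_cover_shape n x : longest_induced_path n x -> covers n x -> (1 < #|T|)%N ->
  finite_shape.
Proof.
move=> Lx cx T2; have [Px n0 _] := Lx; have n1 : (1 < n)%N by rewrite -(card_covers Px cx).
have [|] := boolP [forall i : 'I_n, (i.+1 < n)%N ==> (mult (x i) (x i.+1) == 1%N)].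
  move/forallP => h; apply: (PathShape Px cx n1); apply: Or41 => i ni.
  by have /implyP/(_ ni)/eqP := h (Ordinal (ltnW ni)).
rewrite negb_forall => /existsP[[i /= _]]; rewrite negb_imply => /andP[ni m1].
have [n2|n2] := leqP n 2.
  have ? : n = 2 by lia.
  have ? : i = 0 by lia.
  have := mult_path Px ni; have := mult_path_lt4 Px ni; subst => h4 h0.
  apply: (PathShape Px cx n1) => /=.
  have [|] : mult (x 0) (x 1) = 2 \/ mult (x 0) (x 1) = 3 by lia.
    by move=> m2; apply: Or43; split=> // j; lia.
  by move=> m3; apply: Or42.
have m2 : mult (x i) (x i.+1) = 2.
  by have := mult_path Px ni; have := mult_path_lt3 Px ni n2; lia.
have m_other j : (j.+1 < n)%N -> j != i -> mult (x j) (x j.+1) = 1%N.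
  move=> nj; have := mult_path Px nj; case: (ltngtP j i) => // ij ? _.
    apply/eqP; rewrite eqn_leq andbC; apply/andP; split=> //; rewrite leqNgt; apply/negP => h1.
    by have := mult_path_le1 Px ij ni h1; rewrite m2.
  by apply: (mult_path_le1 Px ij nj); rewrite m2.
case: (posnP i) => [i0|i0].
  apply: (PathShape Px cx n1); apply: Or43; rewrite /= -{1}i0 -{1}i0.
  by subst i; split=> // j ? ?; apply: m_other; lia.
(* Reversal handles a double edge at the far end; it also turns the exclusion of affine F4 into a
   bound from the other side, which leaves only the middle edge of four vertices. *)
have cx' : covers n (fun i => x (n.-1 - i)%N).
  by move=> t; case: (cx t) => j ? ->; exists (n.-1 - j)%N; [lia|rewrite subKn //; lia].
have Px' := induced_path_rev Px.
have [ni2|ni2] := leqP n i.+2.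
  apply: (PathShape Px' cx' n1); apply: Or43; rewrite /=; split.
    by rewrite multC -m2; congr (mult (x _) (x _)); lia.
  move=> j ? ?; rewrite multC (_ : n.-1 - j = (n.-1 - j.+1).+1)%N; last by lia.
  by apply: m_other; lia.
case: (ltnP i.+3 n) => [ni3|ni3]; first by case: (no_F4_affine Px i0 ni3 m2).
case: (ltnP 1 i) => i1.
  case: (no_F4_affine Px' (i := 1)) => //; first by lia.
  by rewrite multC -m2; congr (mult (x _) (x _)); lia.
have {i0 i1} ? : i = 1%N by lia.
have {ni2 ni3 n2} ? : n = 4 by lia.
subst; apply: (PathShape Px cx n1); apply: Or44; split=> //.
by split=> //; apply: m_other.
Qed.

Theorem finite_type_shape : (1 < #|T|)%N -> finite_shape.
Proof.
move=> T2; have [x0 _] : exists x0 : T, x0 \in T by apply/card_gt0P/ltnW.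
case: (longest_path_induced x0) => n [x Lx].
pose J := [set t | t \in map x (iota 0 n)].
have [JT|JT] := eqVneq J setT.
  apply: (path_cover_shape Lx) => // t; have := in_setT t; rewrite -JT inE => /mapP[j].
  by rewrite mem_iota; exists j.
have [Px n0 _] := Lx.
have J0 : J != set0.
  by apply/set0Pn; exists (x 0); rewrite inE; apply: map_f; rewrite mem_iota.
case: (N_connected J0 JT) => s [v [sJ vJ sv]].
have vx : off_path n x v.
  move=> j jn; apply: contraNneq vJ => ->.
  by rewrite inE; apply: map_f; rewrite mem_iota.
move: sJ; rewrite inE => /mapP[k]; rewrite mem_iota add0n => nk sk.
rewrite {}sk adjC in sv.
have cov y : longest_induced_path n y -> off_path n y v -> forall j, (j < n)%N -> adj v (y j) ->
    forall t, t != v -> exists2 j, (j < n)%N & t = y j.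
  move=> Ly vy j nj vj t tv; have : t \in map y (iota 0 n).
    apply: contraNT tv => ty; apply/eqP/(branch_cover Ly vy nj vj) => a na.
    by apply: contraNneq ty => ->; apply: map_f; rewrite mem_iota.
  by case/mapP => a; rewrite mem_iota; exists a.
(* Up to reversal the branch lies in the first half. An index of at least 3 would then leave room
   for affine E7, and index 2 with eight path vertices for affine E8. *)
have shape y j : longest_induced_path n y -> off_path n y v -> (j < n)%N -> adj v (y j) ->
    (j.*2 < n)%N -> finite_shape.
  move=> Ly vy nj vj j2; have [Py _ _] := Ly.
  have j0 := branch_gt0 Ly vy nj vj; have j1 := branch_gt0_rev Ly vy nj vj.
  apply: (BranchShape Py vy (cov _ Ly vy _ nj vj) (branch_adj Ly vy nj vj)
    (mult_branch Ly vy nj vj) (mult_path_branch Ly vy nj vj) j1).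
  have := no_E7_affine Ly vy nj vj; have := no_E8_affine Ly vy nj vj; lia.
case: (ltnP k.*2 n) => k2; first exact: (shape x k).
apply: (shape (fun i => x (n.-1 - i)%N) (n.-1 - k)%N) => //.
- exact: longest_induced_path_rev.
- exact: off_path_rev.
- by lia.
- by rewrite subKn //; lia.
- by lia.
Qed.

End FiniteType.

Local Open Scope ring_scope.

(** * The pencil of a product of reflections *)

Section PrincipalMinors.

Variables (K : comNzRingType) (l : nat).
Implicit Types (A B M : 'M[K]_l) (S : {set 'I_l}).

(** Expansion along row [u] never sees the rest of column [u], where the two matrices may differ. *)
Lemma det_delta_row A B u : (forall j, A u j = (j == u)%:R) ->
  (forall j, B u j = (j == u)%:R) ->
  (forall i j, i != u -> j != u -> A i j = B i j) -> \det A = \det B.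
Proof.
move=> hA hB AB.
have expand (C : 'M[K]_l) : (forall j, C u j = (j == u)%:R) -> \det C = cofactor C u u.
  move=> hC; rewrite (expand_det_row C u) (bigD1 u) //= hC eqxx mul1r big1 ?addr0 //.
  by move=> j ju; rewrite hC (negbTE ju) mul0r.
rewrite !expand //; congr (_ * \det _); apply/matrixP => i j.
by rewrite !mxE AB // eq_sym neq_lift.
Qed.

Definition set_delta_row A v p : 'M[K]_l :=
  \matrix_(i, j) if i == v then (j == p)%:R else A i j.

Lemma det_set_delta_row A v p q b c :
  (forall j, A v j = b * (j == p)%:R + c * (j == q)%:R) ->
  \det A = b * \det (set_delta_row A v p) + c * \det (set_delta_row A v q).
Proof.
move=> hA; apply: (@determinant_multilinear _ _ _ _ _ v).
- by apply/rowP => j; rewrite !mxE eqxx hA.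
- by apply/matrixP => i j; rewrite !mxE eq_sym (negbTE (neq_lift _ _)).
- by apply/matrixP => i j; rewrite !mxE eq_sym (negbTE (neq_lift _ _)).
Qed.

(* Filling up with the identity keeps the size of the matrix fixed. *)
Definition principal_minor M S : K :=
  \det (\matrix_(i, j) if (i \in S) && (j \in S) then M i j else (i == j)%:R).

Lemma principal_minorT M : principal_minor M [set: 'I_l] = \det M.
Proof. by congr (\det _); apply/matrixP => i j; rewrite mxE !inE. Qed.

Lemma principal_minor0 M : principal_minor M set0 = 1.
Proof.
rewrite -[RHS](det1 K l); congr (\det _); apply/matrixP => i j.
by rewrite !mxE inE.
Qed.

Lemma principal_minor_isolated M S v : v \in S ->
  (forall j, j \in S -> j != v -> M v j = 0) ->
  principal_minor M S = M v v * principal_minor M (S :\ v).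
Proof.
move=> vS hM; rewrite {1}/principal_minor.
rewrite (@det_set_delta_row _ v v v (M v v) 0) ?mul0r ?addr0; last first.
  move=> j; rewrite !mxE vS mul0r addr0 /=.
  case: ifP => jS; last first.
    by case: eqVneq jS => [<-|vj _]; rewrite ?vS // mulr0.
  by case: eqVneq => [->|jv]; rewrite ?mulr1 // mulr0 hM.
congr (_ * _); apply: (det_delta_row (u := v)) => [j|j|i j iv jv].
- by rewrite !mxE eqxx.
- by rewrite !mxE !inE eqxx /= eq_sym.
- by rewrite !mxE (negbTE iv) !inE iv jv.
Qed.

(** A permutation contributing to the minor either fixes the leaf [v] or exchanges it with its only
    neighbour [u]; these are the two terms. *)
Lemma principal_minor_leaf M S u v : v \in S -> u \in S -> u != v ->
  (forall j, j \in S -> j != v -> j != u -> M v j = 0 /\ M j v = 0) ->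
  principal_minor M S = M v v * principal_minor M (S :\ v) -
    M v u * M u v * principal_minor M (S :\ v :\ u).
Proof.
move=> vS uS uv hM; rewrite {1}/principal_minor.
set A := \matrix_(i, j) _.
have rowA j : A v j = M v v * (j == v)%:R + M v u * (j == u)%:R.
  rewrite !mxE vS /=; case: (boolP (j \in S)) => jS.
    case: (eqVneq j v) => [->|jv]; first by rewrite eq_sym (negbTE uv) mulr0 addr0 mulr1.
    case: (eqVneq j u) => [->|ju]; first by rewrite mulr0 add0r mulr1.
    by rewrite (hM j jS jv ju).1 !mulr0 addr0.
  rewrite eq_sym; case: (eqVneq j v) jS => [->|jv jS]; first by rewrite vS.
  by case: (eqVneq j u) jS => [->|ju _]; rewrite ?uS // !mulr0 addr0.
rewrite (det_set_delta_row rowA).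
have -> : \det (set_delta_row A v v) = principal_minor M (S :\ v).
  apply: (det_delta_row (u := v)) => [j|j|i j iv jv].
  - by rewrite !mxE eqxx.
  - by rewrite !mxE !inE eqxx /= eq_sym.
  - by rewrite !mxE (negbTE iv) !inE iv jv.
congr (_ + _); rewrite -mulrA -mulrN; congr (_ * _).
(* In the term where row [v] is the unit row at [u], column [v] has [M u v] as its only entry;
   transposing lets the row expansion be used again. *)
rewrite -det_tr; set C := _^T.
have rowC j : C v j = M u v * (j == u)%:R + 0 * (j == u)%:R.
  rewrite mul0r addr0 !mxE [v == u]eq_sym (negbTE uv).
  case: (eqVneq j v) => [->|jv]; first by rewrite eq_sym (negbTE uv) mulr0.
  rewrite vS andbT; case: (eqVneq j u) => [->|ju]; first by rewrite uS mulr1.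
  by rewrite mulr0; case: ifP => // jS; rewrite (hM j jS jv ju).2.
rewrite (det_set_delta_row rowC) mul0r addr0 -mulrN; congr (_ * _).
(* Row and column [v] of [D] are now unit vectors at [u]. Exchanging rows [u] and [v] gives the
   minus sign and moves both ones to the diagonal; [G] clears what remains of column [u]. *)
set D := set_delta_row C v u.
have -> : \det D = - \det (xrow u v D).
  by rewrite xrowE det_mulmx det_perm odd_tperm uv expr1 mulN1r opprK.
congr (- _).
have DE i j : xrow u v D i j = D (tperm u v i) j by rewrite mxE.
pose G := \matrix_(i, j) if (i == u) || (j == u) then (i == j)%:R else xrow u v D i j.
have -> : \det (xrow u v D) = \det G.
  apply: (det_delta_row (u := u)) => [j|j|i j iu ju].
  - by rewrite DE tpermL mxE eqxx.
  - by rewrite mxE eqxx /= eq_sym.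
  - by rewrite [RHS]mxE (negbTE iu) (negbTE ju).
rewrite -det_tr; apply: (det_delta_row (u := v)) => [j|j|i j iv jv].
- rewrite mxE [LHS]mxE [v == u]eq_sym (negbTE uv) orbF; case: ifP => [/eqP->|/negbT ju].
    by rewrite (negbTE uv).
  rewrite DE; case: (eqVneq j v) => [->|jv].
    by rewrite tpermR mxE (negbTE uv) mxE mxE !eqxx.
  by rewrite tpermD 1?eq_sym // mxE (negbTE jv) mxE mxE eqxx (negbTE ju).
- by rewrite !mxE !inE eqxx /= andbF /= eq_sym.
rewrite [RHS]mxE [LHS]mxE [LHS]mxE !inE iv jv /=.
case: (eqVneq j u) => [->|ju] /=; first by rewrite andbF eq_sym.
case: (eqVneq i u) => [->|iu] /=; first by rewrite eq_sym.
rewrite DE tpermD 1?eq_sym // mxE (negbTE jv) mxE mxE (negbTE iv).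
by rewrite mxE [j == i]eq_sym.
Qed.


End PrincipalMinors.

(** * Products of reflections in coordinates *)

Section PseudoReflections.

Variables (K : comNzRingType) (l : nat) (B : 'M[K]_l).

(** For [B] the transposed Cartan matrix this is a simple reflection in the basis of simple roots:
    only coordinate [i] changes, by row [i] of [B]. *)
Definition pseudo_refl (i : 'I_l) : 'M[K]_l := 1%:M - \matrix_(k, j) (B i j *+ (k == i)).

Lemma row_pseudo_refl (i : 'I_l) (X : 'M[K]_l) k : row k (pseudo_refl i *m X) =
  row k X - (\sum_j B i j *: row j X) *+ (k == i).
Proof.
rewrite mulmxBl mul1mx linearB /=; congr (_ - _).
apply/rowP => j; rewrite mulmxnE !mxE summxE -sumrMnl; apply: eq_bigr => a _.
by rewrite !mxE mulrnAl.
Qed.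

(* The k-th coordinate is changed once, by the k-th reflection, at a moment when exactly the
   later coordinates have been changed. *)
Lemma row_prod_pseudo_refl (r : seq 'I_l) : sorted ltn (map val r) -> (forall i, B i i = 2) ->
  let X := \prod_(i <- r) pseudo_refl i in
  (forall k, k \notin r -> row k X = row k 1%:M) /\
  (forall k, k \in r -> row k X + \sum_(j | j != k)
    B k j *: row j (if (j \in r) && (k < j)%N then X else 1%:M) = - row k 1%:M).
Proof.
move=> + B2; elim: r => [|i r IH] /=.
  by rewrite big_nil; split.
move=> pr; have /= [IH1 IH2] := IH (path_sorted pr).
have ir j : j \in r -> (i < j)%N.
  move=> jr; have := order_path_min ltn_trans pr => /allP; apply.
  exact: map_f.
have inr : i \notin r by apply/negP => /ir; rewrite ltnn.
rewrite big_cons; set X := \prod_(i <- r) _ in IH1 IH2 *.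
have rowX k : k != i -> row k (pseudo_refl i * X) = row k X.
  by move=> /negbTE ki; rewrite row_pseudo_refl ki mulr0n subr0.
split=> [k|k].
  by rewrite inE negb_or => /andP[ki kr]; rewrite rowX // IH1.
rewrite inE => /predU1P[->|kr]; last first.
  have ki : k != i by apply: contraNneq inr => <-.
  rewrite rowX // -[RHS](IH2 k kr); congr (_ + _); apply: eq_bigr => j jk.
  rewrite inE; case: (eqVneq j i) => [->|ji] /=.
    by rewrite ltnNge (ltnW (ir k kr)) /= (negbTE inr).
  by case: ifP => //; rewrite rowX.
rewrite row_pseudo_refl eqxx mulr1n IH1 // (bigD1 i) //= B2.
rewrite [X in _ + X](_ : _ = \sum_(j | j != i) B i j *: row j X); last first.
  apply: eq_bigr => j ji; rewrite inE (negbTE ji) /=; case: (boolP (j \in r)) => jr.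
    by rewrite ir // rowX.
  by rewrite IH1.
rewrite IH1 // opprD addrA subrK.
by rewrite scaler_nat mulr2n opprD addrA subrr add0r.
Qed.

(** The entries 2 on the diagonal of [B] are split as 1 + 1 between the two triangular parts, whence
    [z + 1]. *)
Definition coxeter_pencil (z : K) : 'M[K]_l :=
  \matrix_(i, j) if i == j then z + 1 else if (i < j)%N then z * B i j else B i j.

Lemma det_prod_pseudo_refl (z : K) : (forall i, B i i = 2) ->
  \det (z%:M - \prod_(i < l) pseudo_refl i) = \det (coxeter_pencil z).
Proof.
move=> B2; pose U : 'M[K]_l := \matrix_(i, j) if i == j then 1 else if (i < j)%N then B i j else 0.
set X := \prod_(i < l) _.
have detU : \det U = 1.
  rewrite -det_tr det_trig; last first.
    apply/is_trig_mxP => i j ij; rewrite !mxE ltnNge (ltnW ij) /=.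
    by case: eqVneq ij => // ->; rewrite ltnn.
  by rewrite big1 // => i _; rewrite !mxE eqxx.
rewrite -[LHS]mul1r -detU -det_mulmx mulmxBr; congr (\det _).
(* In the row identities for the product, later rows of [X] build up [U *m X], while earlier rows
   enter as identity rows and supply the lower triangular part. *)
have UX : U *m X = - \matrix_(i, j) (if i == j then 1 else if (i < j)%N then 0 else B i j).
  apply/row_matrixP => k.
  have srt : sorted ltn (map val (index_enum 'I_l)).
    by rewrite /index_enum -enumT val_enum_ord iota_ltn_sorted.
  have [_ /(_ k (mem_index_enum k))] := row_prod_pseudo_refl srt B2.
  rewrite -/X => /(congr1 (fun v => v - \sum_(j | j != k) 
    B k j *: row j (if (k < j)%N then 0 else 1%:M))).
  rewrite -addrA -sumrB => E.
  transitivity (row k X + \sum_(j | j != k) U k j *: row j X).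
    by rewrite row_mul mulmx_sum_row (bigD1 k) //= !mxE eqxx scale1r;
      congr (_ + _); apply: eq_bigr => j _; rewrite mxE.
  transitivity (- row k 1%:M - \sum_(j | j != k) B k j *: row j (if (k < j)%N then 0 else 1%:M)).
    rewrite -{}E; congr (_ + _); apply: eq_bigr => j jk.
    rewrite mem_index_enum /= mxE eq_sym (negbTE jk).
    by case: ifP => _; [rewrite linear0 scaler0 subr0 | rewrite scale0r subrr].
  rewrite linearN -opprD; congr (- _); apply/rowP => j.
  rewrite !mxE summxE; case: (eqVneq k j) => [->|kj].
    rewrite big1 ?addr0 // => i ij; rewrite !mxE; case: ifP; rewrite !mxE ?mulr0 //.
    by rewrite (negbTE ij) mulr0.
  rewrite add0r (bigD1 j) 1?eq_sym //= big1 ?addr0 => [|i /andP[ik ij]].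
    by rewrite !mxE; case: ifP => _; rewrite !mxE ?mulr0 // eqxx mulr1.
  by rewrite !mxE; case: ifP => _; rewrite !mxE ?mulr0 // (negbTE ij) mulr0.
rewrite UX opprK mul_mx_scalar; apply/matrixP => i j; rewrite !mxE.
by case: eqP => _; [rewrite mulr1|case: ifP => _; rewrite ?addr0 ?mulr0 ?add0r].
Qed.

End PseudoReflections.

Lemma map_iotaSr (T : Type) (x : nat -> T) k :
  map x (iota 0 k.+1) = rcons (map x (iota 0 k)) (x k).
Proof. by rewrite -addn1 iotaD map_cat cats1. Qed.

(** * Characteristic polynomials by removal of leaves *)

Section DynkinMinors.

Variables (K : comNzRingType) (l : nat) (N : 'I_l -> 'I_l -> nat) (z : K) (M : 'M[K]_l).
Hypotheses (adjC : symmetric (adj N)) (M_diag : forall i, M i i = z + 1).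
Hypothesis M_adj : forall i j, ~~ adj N i j -> i != j -> M i j = 0.
Hypothesis M_mult : forall i j, i != j -> M i j * M j i = z * (mult N i j)%:R.

Definition seq_minor (s : seq 'I_l) : K := principal_minor M [set i in s].

Lemma eq_seq_minor s s' : s =i s' -> seq_minor s = seq_minor s'.
Proof. by move=> ss'; congr principal_minor; apply/setP => i; rewrite !inE. Qed.

Lemma set_rconsD1 (s : seq 'I_l) v : v \notin s -> [set i in rcons s v] :\ v = [set i in s].
Proof.
move=> vs; apply/setP => i; rewrite !inE mem_rcons inE.
by case: eqVneq => [->|] //=; rewrite (negbTE vs).
Qed.

Lemma seq_minor_isolated s v : v \notin s -> (forall j, j \in s -> ~~ adj N v j) ->
  seq_minor (rcons s v) = (z + 1) * seq_minor s.
Proof.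
move=> vs hv; rewrite /seq_minor (@principal_minor_isolated _ _ _ _ v).
- by rewrite M_diag set_rconsD1.
- by rewrite inE mem_rcons mem_head.
- move=> j; rewrite inE mem_rcons inE => /predU1P[->|js]; first by rewrite eqxx.
  by move=> jv; rewrite M_adj // ?hv // eq_sym.
Qed.

(** The product of two opposite entries is [z] times the multiplicity, whichever of them carries the
    factor [z]; hence neither the numbering of the simple roots nor the direction of an edge
    matters. *)
Lemma seq_minor_leaf s u v : uniq (rcons (rcons s u) v) ->
  (forall j, j \in s -> ~~ adj N v j) -> seq_minor (rcons (rcons s u) v) =
  (z + 1) * seq_minor (rcons s u) - z * (mult N u v)%:R * seq_minor s.
Proof.
rewrite rcons_uniq => /andP[vs]; rewrite rcons_uniq => /andP[us _] hv.
have uv : u != v by apply: contraNneq vs => <-; rewrite mem_rcons inE eqxx.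
rewrite /seq_minor (@principal_minor_leaf _ _ _ _ u v) //.
- by rewrite M_diag set_rconsD1 // set_rconsD1 // [M v u * _]mulrC M_mult.
- by rewrite inE mem_rcons mem_head.
- by rewrite inE mem_rcons inE mem_rcons mem_head orbT.
- move=> j; rewrite inE mem_rcons inE mem_rcons inE => /or3P[/eqP->|/eqP->|js];
    rewrite ?eqxx // => jv _.
  by split; apply: M_adj; rewrite ?hv // 1?eq_sym // adjC hv.
Qed.

Lemma seq_minorT s : (forall t, t \in s) -> seq_minor s = \det M.
Proof.
by move=> sT; rewrite -principal_minorT; congr principal_minor; apply/setP => i; rewrite !inE sT.
Qed.

Section Path.

Variables (n : nat) (x : nat -> 'I_l).
Hypothesis Px : induced_path N n x.

Definition path_minor k := seq_minor (map x (iota 0 k)).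

Lemma path_minor0 : path_minor 0 = 1.
Proof.
by rewrite -(principal_minor0 M); congr principal_minor; apply/setP => i; rewrite !inE.
Qed.

Lemma path_minor1 : path_minor 1 = z + 1.
Proof.
by rewrite /path_minor map_iotaSr seq_minor_isolated //
  -/(path_minor 0) path_minor0 mulr1.
Qed.

Lemma path_minorSS k : (k.+1 < n)%N -> path_minor k.+2 =
  (z + 1) * path_minor k.+1 - z * (mult N (x k) (x k.+1))%:R * path_minor k.
Proof.
move=> kn; rewrite /path_minor !map_iotaSr seq_minor_leaf //.
  rewrite -!map_iotaSr; apply: (uniq_map_path Px); first exact: iota_uniq.
  by move=> i; rewrite mem_iota; lia.
move=> j /mapP[a]; rewrite mem_iota => /andP[_ ik] ->.
by rewrite adjC; case: Px => _ _ ->; lia.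
Qed.

Lemma path_minor_typeA : (forall i, (i.+1 < n)%N -> mult N (x i) (x i.+1) = 1%N) ->
  forall k, (k <= n)%N -> (z - 1) * path_minor k = z ^+ k.+1 - 1.
Proof.
move=> m1; suff h k : (k < n)%N -> (z - 1) * path_minor k = z ^+ k.+1 - 1 /\
    (z - 1) * path_minor k.+1 = z ^+ k.+2 - 1.
  case=> [|k]; first by rewrite path_minor0 mulr1 expr1.
  by case/h.
elim: k => [|k IH] kn.
  by rewrite path_minor0 path_minor1 !exprS expr0; split; ring.
have [IH1 IH2] := IH (ltnW kn); split=> //.
rewrite path_minorSS // m1 // mulr1 mulrBr mulrCA IH2 [(z - 1) * (z * _)]mulrCA IH1.
by rewrite !exprS; ring.
Qed.

Lemma path_minor_typeB : mult N (x 0%N) (x 1%N) = 2%N ->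
  (forall i, (0 < i)%N -> (i.+1 < n)%N -> mult N (x i) (x i.+1) = 1%N) ->
  forall k, (k < n)%N -> path_minor k.+1 = z ^+ k.+1 + 1.
Proof.
move=> m2 m1; suff h k : (k.+1 < n)%N -> path_minor k.+1 = z ^+ k.+1 + 1 /\
    path_minor k.+2 = z ^+ k.+2 + 1.
  case=> [_|k]; first by rewrite path_minor1.
  by case/h.
elim: k => [|k IH] kn.
  rewrite path_minorSS // path_minor1 path_minor0 m2.
  by rewrite !exprS expr0; split; ring.
have [IH1 IH2] := IH (ltnW kn); split=> //.
by rewrite path_minorSS // m1 // IH2 IH1 !exprS; ring.
Qed.

Lemma path_minor_typeF : n = 4%N -> mult N (x 0%N) (x 1%N) = 1%N -> mult N (x 1%N) (x 2%N) = 2%N ->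
  mult N (x 2%N) (x 3%N) = 1%N -> path_minor 4 = z ^+ 4 - z ^+ 2 + 1.
Proof.
move=> n4 m0 m1 m2.
have p2 : path_minor 2 = (z + 1) * (z + 1) - z.
  by rewrite path_minorSS ?n4 // path_minor1 path_minor0 m0; ring.
have p3 : path_minor 3 = (z + 1) * path_minor 2 - z * 2 * (z + 1).
  by rewrite path_minorSS ?n4 // path_minor1 m1; ring.
by rewrite path_minorSS ?n4 // m2 p3 p2; ring.
Qed.

Section Branch.

Variables (v : 'I_l) (i : nat).
Hypotheses (vx : off_path n x v) (ni : (i < n)%N).
Hypothesis vadj : forall j, (j < n)%N -> adj N v (x j) = (j == i).
Hypotheses (mv : mult N v (x i) = 1%N).
Hypothesis m1 : forall k, (k.+1 < n)%N -> mult N (x k) (x k.+1) = 1%N.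

(** The vertex [v] is present from the start: isolated while [k <= i], a leaf at [x i] for
    [k = i.+1]; from then on the leaf removed is the end of the path. *)
Definition branch_minor k := seq_minor (v :: map x (iota 0 k)).

Let v_notin k : (k <= n)%N -> v \notin map x (iota 0 k).
Proof.
move=> kn; apply/mapP => -[j]; rewrite mem_iota => /andP[_ jk] vj.
by have := vx (leq_trans jk kn); rewrite vj eqxx.
Qed.

Let uniq_x k : (k <= n)%N -> uniq (map x (iota 0 k)).
Proof.
move=> kn; apply: (uniq_map_path Px); first exact: iota_uniq.
by move=> j; rewrite mem_iota; lia.
Qed.

Lemma branch_minor_init k : (k <= i)%N -> branch_minor k = (z + 1) * path_minor k.
Proof.
move=> ki; rewrite /branch_minor -[RHS](@seq_minor_isolated _ v).
- by apply: eq_seq_minor => j; rewrite mem_rcons.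
- by apply: v_notin; lia.
- by move=> j /mapP[a]; rewrite mem_iota => ? ->; rewrite vadj; lia.
Qed.

Lemma branch_minor_vertex :
  branch_minor i.+1 = (z + 1) * path_minor i.+1 - z * path_minor i.
Proof.
rewrite /branch_minor (@eq_seq_minor _ (rcons (map x (iota 0 i.+1)) v)); last first.
  by move=> j; rewrite mem_rcons.
rewrite {1}map_iotaSr seq_minor_leaf; first by rewrite -map_iotaSr multC mv mulr1.
  by rewrite -map_iotaSr rcons_uniq v_notin // uniq_x.
by move=> j /mapP[a]; rewrite mem_iota => ? ->; rewrite vadj; lia.
Qed.

Lemma branch_minorSS k : (i <= k)%N -> (k.+1 < n)%N ->
  branch_minor k.+2 = (z + 1) * branch_minor k.+1 - z * branch_minor k.
Proof.
move=> ik kn; rewrite /branch_minor !map_iotaSr -!rcons_cons seq_minor_leaf ?m1 ?mulr1 //.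
  rewrite -[rcons (rcons (v :: _) _) _]/(v :: rcons (rcons _ _) _) -!map_iotaSr cons_uniq.
  by rewrite v_notin // uniq_x.
move=> j; rewrite inE => /predU1P[->|].
  by rewrite adjC vadj //; lia.
move/mapP => [a]; rewrite mem_iota => /andP[_ ak] ->.
by rewrite adjC; case: Px => _ _ ->; lia.
Qed.

Lemma branch_minor_typeD : i = 1%N ->
  forall k, (k < n)%N -> branch_minor k.+1 = (z + 1) * (z ^+ k.+1 + 1).
Proof.
move=> i1; have n1 : (1 < n)%N by rewrite -i1.
have p2 : path_minor 2 = (z + 1) * (z + 1) - z.
  by rewrite path_minorSS // m1 // path_minor1 path_minor0; ring.
have r1 : branch_minor 1 = (z + 1) * (z + 1) by rewrite branch_minor_init ?i1 // path_minor1.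
have r2 : branch_minor 2 = (z + 1) * (z ^+ 2 + 1).
  by have := branch_minor_vertex; rewrite i1 p2 path_minor1 => ->; ring.
suff h k : (k.+1 < n)%N -> branch_minor k.+1 = (z + 1) * (z ^+ k.+1 + 1) /\
    branch_minor k.+2 = (z + 1) * (z ^+ k.+2 + 1).
  case=> [_|k]; first by rewrite r1 expr1.
  by case/h.
elim: k => [|k IH] kn; first by rewrite r1 r2 expr1.
have [IH1 IH2] := IH (ltnW kn); split=> //.
by rewrite branch_minorSS ?i1 // IH2 IH1 !exprS; ring.
Qed.

(** Counting [v], these are E6, E7 and E8. The values are the products of cyclotomic polynomials of
    indices 3 and 12, of indices 2 and 18, and the one of index 30. *)
Lemma branch_minor_typeE : i = 2%N -> (4 < n)%N ->
  [/\ branch_minor 5 = (z ^+ 2 + z + 1) * (z ^+ 4 - z ^+ 2 + 1),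
      (5 < n)%N -> branch_minor 6 = (z + 1) * (z ^+ 6 - z ^+ 3 + 1) &
      (6 < n)%N -> branch_minor 7 =
        z ^+ 8 + z ^+ 7 - z ^+ 5 - z ^+ 4 - z ^+ 3 + z + 1].
Proof.
move=> i2 n4.
have p2 : path_minor 2 = (z + 1) * (z + 1) - z.
  by rewrite path_minorSS ?m1 ?path_minor1 ?path_minor0 //; [ring|lia..].
have p3 : path_minor 3 = (z + 1) * path_minor 2 - z * (z + 1).
  by rewrite path_minorSS ?m1 ?path_minor1 //; [ring|lia..].
have r2 : branch_minor 2 = (z + 1) * path_minor 2 by rewrite branch_minor_init ?i2.
have r3 : branch_minor 3 = (z + 1) * path_minor 3 - z * path_minor 2.
  by have := branch_minor_vertex; rewrite i2.
have r4 : branch_minor 4 = (z + 1) * branch_minor 3 - z * branch_minor 2.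
  by rewrite branch_minorSS ?i2 //; lia.
have r5 : branch_minor 5 = (z + 1) * branch_minor 4 - z * branch_minor 3.
  by rewrite branch_minorSS ?i2 //; lia.
split=> [|n5|n6].
- by rewrite r5 r4 r3 r2 p3 p2; ring.
- by rewrite branch_minorSS ?i2 // r5 r4 r3 r2 p3 p2; ring.
- rewrite branch_minorSS ?i2 // branch_minorSS ?i2 //; last by lia.
  by rewrite r5 r4 r3 r2 p3 p2; ring.
Qed.

End Branch.
End Path.
End DynkinMinors.

(** * Exponents as roots of unity *)

Section RootsOfUnity.

Variable R : realType.
Implicit Types (t a b : R) (k h n : nat).

Lemma expiD t a : expi (t + a) = expi t * expi a.
Proof. by rewrite /expi cosD sinD; congr Complex; rewrite addrC mulrC. Qed.

Lemma expi0 : expi (0 : R) = 1.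
Proof. by rewrite /expi cos0 sin0. Qed.

Lemma expi_mulrn t n : expi (t *+ n) = expi t ^+ n.
Proof. by elim: n => [|n IH]; rewrite ?mulr0n ?expi0 ?expr0 // mulrS expiD IH exprS. Qed.

Lemma expi2pi : expi (2 * pi : R) = 1.
Proof. by rewrite mulr_natl /expi cos2pi sin2pi. Qed.

Lemma expi_eq1 t : 0 <= t < 1 -> expi (2 * pi * t) = 1 -> t = 0.
Proof.
move=> /andP[t0 t1] E; apply/eqP; rewrite eq_le t0 andbT leNgt; apply/negP => tp.
have s0 : 0 < sin (pi * t).
  apply: sin_gt0_pi; rewrite mulr_gt0 ?pi_gt0 //=.
  by rewrite -[ltRHS]mulr1 ltr_pM2l ?pi_gt0.
have : cos (2 * pi * t) = 1 by move: E => /(congr1 (@complex.Re R)).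
rewrite -mulrA mulr_natl cos_mulr2n => h.
have := cos2Dsin2 (pi * t); have := exprn_gt0 2 s0; lra.
Qed.

Lemma expi_inj a b : 0 <= a < 1 -> 0 <= b < 1 ->
  expi (2 * pi * a) = expi (2 * pi * b) -> a = b.
Proof.
wlog ab : a b / a <= b => [h|] a1 b1 E.
  by case: (leP a b) => [|/ltW] ab; [apply: h|symmetry; apply: h].
suff : b - a = 0 by move/eqP; rewrite subr_eq0 => /eqP.
apply: expi_eq1; first by lra.
have : expi (2 * pi * a) * expi (2 * pi * (b - a)) = expi (2 * pi * a) * 1.
  by rewrite -expiD mulr1 E; congr expi; ring.
apply: mulfI; apply/eqP => e0.
have := expiD (2 * pi * a) (- (2 * pi * a)); rewrite subrr expi0 e0 mul0r.
by move/eqP; rewrite oner_eq0.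
Qed.

Lemma expi_fracX h k n :
  expi (2 * pi * k%:R / h%:R : R) ^+ n = expi (2 * pi * (k * n)%N%:R / h%:R : R).
Proof. by rewrite -expi_mulrn -mulr_natr natrM; congr expi; ring. Qed.

Lemma expi_frac_eq1 h k : (0 < h)%N -> (expi (2 * pi * k%:R / h%:R : R) == 1) = (h %| k)%N.
Proof.
move=> h0; have hn0 : h%:R != 0 :> R by rewrite pnatr_eq0 -lt0n.
have E : expi (2 * pi * k%:R / h%:R : R) = expi (2 * pi * ((k %% h)%N%:R / h%:R) : R).
  have kE : k%:R = (k %/ h)%N%:R * h%:R + (k %% h)%N%:R :> R.
    by rewrite -natrM -natrD -divn_eq.
  have -> : 2 * pi * k%:R / h%:R = (2 * pi) *+ (k %/ h) + 2 * pi * ((k %% h)%N%:R / h%:R) :> R.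
    by rewrite {1}kE -mulr_natr; field.
  by rewrite expiD expi_mulrn expi2pi expr1n mul1r.
rewrite E; apply/eqP/idP => [|hk]; last by rewrite (eqP hk) mul0r mulr0 expi0.
move/expi_eq1; rewrite divr_ge0 ?ler0n //= ltr_pdivrMr ?ltr0n // mul1r ltr_nat ltn_mod h0.
move=> /(_ isT) /eqP; rewrite mulf_eq0 invr_eq0 (negbTE hn0) orbF pnatr_eq0.
by [].
Qed.

Lemma expi_frac_inj h H k j : (0 < h)%N -> (0 < H)%N -> (k < H)%N -> (j < h)%N ->
  expi (2 * pi * j%:R / h%:R : R) = expi (2 * pi * k%:R / H%:R) -> (j * H = k * h)%N.
Proof.
move=> h0 H0 kH jh; rewrite -!(mulrA (2 * pi)).
move/expi_inj; rewrite !divr_ge0 ?ler0n //= !ltr_pdivrMr ?ltr0n // !mul1r !ltr_nat kH jh.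
move=> /(_ isT isT) /eqP; rewrite eqr_div ?pnatr_eq0 -?lt0n //.
by rewrite -!natrM eqr_nat => /eqP.
Qed.

End RootsOfUnity.

(** The last nonzero power of [x - 1] absorbs powers of [x], so factoring [x ^+ h - 1] shows that
    [h] times this power vanishes. By torsion-freeness the nilpotency index drops until [x - 1]
    itself is zero. *)
Lemma unipotent_finite_order (A : pzRingType) (x : A) h s : (0 < h)%N ->
  (forall y : A, y *+ h = 0 -> y = 0) -> x ^+ h = 1 -> (x - 1) ^+ s = 0 -> x = 1.
Proof.
move=> h0 torsion xh; elim: s => [|s IH].
  by rewrite expr0 => A0; rewrite -[x]mulr1 -[RHS]mulr1 A0 !mulr0.
case: s IH => [_|s IH xs]; first by rewrite expr1 => /eqP; rewrite subr_eq0 => /eqP.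
apply: IH; apply: torsion.
have y1 i : (x - 1) ^+ s.+1 * x ^+ i = (x - 1) ^+ s.+1.
  elim: i => [|i IH]; first by rewrite expr0 mulr1.
  rewrite [x ^+ i.+1]exprSr mulrA IH -{2}[x](subrK 1) mulrDr mulr1 -exprSr xs.
  by rewrite add0r.
have : (x - 1) ^+ s * (x ^+ h - 1) = 0 by rewrite xh subrr mulr0.
rewrite subrX1 mulrA -exprSr mulr_sumr => <-.
by under eq_bigr => i _ do rewrite y1; rewrite sumr_const card_ord.
Qed.

(** The characteristic polynomial divides a power of X^H - 1, so by Cayley-Hamilton [A ^+ H] is
    unipotent; it also has finite order. *)
Lemma mx_order_of_roots (F : numFieldType) l (A : 'M[F]_l) (e : 'I_l -> F) h H :
  (0 < h)%N -> A ^+ h = 1 -> char_poly A = \prod_(j < l) ('X - (e j)%:P) ->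
  (forall j, e j ^+ H = 1) -> A ^+ H = 1.
Proof.
case: l A e => [|l] A e h0 Ah pA eH; first by rewrite !thinmx0.
apply: (unipotent_finite_order (h := h) (s := l.+1)) => //.
- by move=> Y /eqP; rewrite -scaler_nat scaler_eq0 pnatr_eq0 gtn_eqF //= => /eqP.
- by rewrite -exprM mulnC exprM Ah expr1n.
have /fin_all_exists [q qE] j : exists q, 'X^H - 1 = ('X - (e j)%:P) * q.
  have : root ('X^H - 1) (e j) by rewrite /root !hornerE eH subrr.
  by move/factor_theorem => [q ->]; exists q; rewrite mulrC.
have E : ('X^H - 1) ^+ l.+1 = char_poly A * \prod_(j < l.+1) q j.
  by rewrite pA -big_split /=; under eq_bigr => j _ do rewrite -qE; rewrite prodr_const card_ord.
have := congr1 (horner_mx A) E; rewrite rmorphM /= Cayley_Hamilton mul0r rmorphXn /=.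
by rewrite rmorphB rmorph1 rmorphXn /= horner_mx_X.
Qed.

Section Exponents.

Variables (R : realType) (l : nat) (C : 'M[R]_l) (m : l.-tuple nat) (h H : nat).
Hypotheses (C_order : has_order C h) (m_lt : forall j, (0 < tnth m j < h)%N).
Let p := char_poly (map_mx (real_complex R) C).
Hypothesis pE : p = \prod_(j < l) ('X - (expi (2 * pi * (tnth m j)%:R / h%:R))%:P).
Hypotheses (H0 : (0 < H)%N) (rootH : forall z, root p z -> z ^+ H = 1).

Lemma coxeter_order_le : (h <= H)%N.
Proof.
have [h0 Ch hmin] := C_order; rewrite leqNgt; apply/negP => Hh.
apply: (hmin H); first by rewrite H0.
have mapX k : map_mx (real_complex R) (C ^+ k) = map_mx (real_complex R) C ^+ k.
  by elim: k => [|k IH]; rewrite ?expr0 ?map_mx1 // !exprS map_mxM IH.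
apply: (@map_mx_inj _ _ (real_complex R)); rewrite mapX map_mx1.
apply: (mx_order_of_roots h0 _ pE); first by rewrite -mapX Ch map_mx1.
move=> j; apply: rootH.
by rewrite /root pE horner_prod (bigD1 j) //= hornerXsubC subrr mul0r.
Qed.

Lemma exponent_of_root k : (k < H)%N -> root p (expi (2 * pi * k%:R / H%:R)) ->
  exists2 j, (tnth m j * H = k * h)%N & (tnth m j <= k)%N.
Proof.
move=> kH; have [h0 _ _] := C_order.
rewrite /root pE horner_prod => /prodf_eq0[j _]; rewrite hornerXsubC subr_eq0 => /eqP E.
have /andP[_ jh] := m_lt j.
have EH := expi_frac_inj h0 H0 kH jh (esym E); exists j => //.
by rewrite -(leq_pmul2r H0) EH leq_mul2l coxeter_order_le orbT.
Qed.

Lemma second_exponent_le k (l2 : (1 < l)%N) : sorted leq m -> (1 < k < H)%N ->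
  root p (expi (2 * pi / H%:R)) -> root p (expi (2 * pi * k%:R / H%:R)) ->
  (tnth m (Ordinal l2) <= k)%N.
Proof.
move=> ms /andP[k1 kH]; rewrite -[2 * pi]mulr1 -[1]/(1%:R) => r1 rk.
have [i Ei i1] := exponent_of_root (ltn_trans k1 kH) r1.
rewrite mulr1 in rk; have [j Ej jk] := exponent_of_root kH rk.
have ij : i != j.
  by apply: contraTneq k1 => ij; move: Ei Ej; rewrite ij => ->; have [] := C_order; nia.
have mono a b : (a <= b < l)%N -> (nth 0%N m a <= nth 0%N m b)%N.
  case/andP=> ab bl; apply: (sorted_leq_nth leq_trans leqnn) => //; rewrite inE size_tuple //.
  exact: leq_ltn_trans bl.
rewrite (tnth_nth 0%N) /=; move: i1 jk; rewrite !(tnth_nth 0%N) => i1 jk.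
have := ltn_ord i; have := ltn_ord j; move: ij; rewrite -val_eqE /= => ij jl il.
(* Of two distinct indices at least one is positive, and its exponent dominates the second one. *)
case: (ltnP 0 i) => i0; first by apply: leq_trans (mono 1%N i _) _; lia.
by apply: leq_trans (mono 1%N j _) _; lia.
Qed.

End Exponents.

(** * Simple systems and their highest root *)

Section InnerProduct.

Variables (R : realType) (l : nat).
Implicit Types (u v w : 'cV[R]_l).

Lemma dotvC u v : dotv u v = dotv v u.
Proof. by apply: eq_bigr => i _; rewrite mulrC. Qed.

Lemma dotvDl u v w : dotv (u + v) w = dotv u w + dotv v w.
Proof. by rewrite -big_split; apply: eq_bigr => i _; rewrite mxE mulrDl. Qed.

Lemma dotvZl k u v : dotv (k *: u) v = k * dotv u v.
Proof. by rewrite mulr_sumr; apply: eq_bigr => i _; rewrite mxE mulrA. Qed.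

Lemma dotvNl u v : dotv (- u) v = - dotv u v.
Proof. by rewrite -scaleN1r dotvZl mulN1r. Qed.

Lemma dotv0l v : dotv 0 v = 0.
Proof. by rewrite -(scale0r 0) dotvZl mul0r. Qed.

Lemma dotv_suml (I : finType) (F : I -> 'cV[R]_l) v :
  dotv (\sum_i F i) v = \sum_i dotv (F i) v.
Proof.
apply: (big_morph (fun u => dotv u v)) => [x y|]; first exact: dotvDl.
exact: dotv0l.
Qed.

Lemma dotv_gt0 v : v != 0 -> 0 < dotv v v.
Proof.
move=> v0; have nn i : true -> 0 <= v i 0 * v i 0 by rewrite -expr2 sqr_ge0.
rewrite lt_def sumr_ge0 ?andbT //; apply: contra v0 => /eqP v2.
apply/eqP/colP => i; rewrite mxE; apply/eqP.
have /eqP := psumr_eq0P nn v2 (i := i) isT.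
by rewrite mulf_eq0 orbb.
Qed.

Lemma refl_mxE u v : refl_mx u *m v = v - cartan_int v u *: u.
Proof.
rewrite mulmxBl mul1mx -scalemxAl -mulmxA; congr (_ - _).
have -> : u^T *m v = (dotv v u)%:M.
  apply/matrixP => i j; rewrite !ord1 !mxE eqxx mulr1n; apply: eq_bigr => k _.
  by rewrite mxE mulrC.
by rewrite mul_mx_scalar scalerA /cartan_int mulrAC.
Qed.

Lemma cartan_int_suml (I : finType) (k : I -> R) (F : I -> 'cV[R]_l) v :
  cartan_int (\sum_i k i *: F i) v = \sum_i k i * cartan_int (F i) v.
Proof.
rewrite /cartan_int dotv_suml mulr_sumr mulr_suml; apply: eq_bigr => i _.
by rewrite dotvZl; ring.
Qed.

Lemma cartan_intvv v : v != 0 -> cartan_int v v = 2.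
Proof. by move=> v0; rewrite /cartan_int mulfK // gt_eqF // dotv_gt0. Qed.

Lemma cartan_int_dotv u v : v != 0 -> cartan_int u v * dotv v v = 2 * dotv u v.
Proof. by move=> v0; rewrite /cartan_int divfK // gt_eqF // dotv_gt0. Qed.

End InnerProduct.

Section SimpleSystem.

Variables (R : realType) (l : nat) (Phi Pos : {fset 'cV[R]_l}) (alpha : 'I_l -> 'cV[R]_l).
Hypotheses (Phi_root : is_root_system Phi) (Phi_crys : crystallographic Phi).
Hypotheses (Pos_pos : is_positive_system Phi Pos) (alpha_simple : is_simple_system Pos alpha).

Lemma alpha_free (k : 'I_l -> R) : \sum_i k i *: alpha i = 0 -> forall i, k i = 0.
Proof.
have [/andP[_ fr] _ _] := alpha_simple.
pose X := [tuple alpha i | i < l]; have XE : [seq alpha i | i <- enum 'I_l] = X by [].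
move: fr; rewrite XE => /freeP h k0; apply: h; rewrite -[RHS]k0.
by apply: eq_bigr => i _; rewrite -(tnth_nth 0) tnth_mktuple.
Qed.

Lemma alpha_inj (k k' : 'I_l -> R) :
  \sum_i k i *: alpha i = \sum_i k' i *: alpha i -> k =1 k'.
Proof.
move=> E i; apply/eqP; rewrite -subr_eq0; apply/eqP.
apply: (@alpha_free (fun i => k i - k' i)).
by under eq_bigr => j _ do rewrite scalerBl; rewrite sumrB E subrr.
Qed.

Lemma alpha_Phi i : alpha i \in Phi.
Proof.
have [_ aP _] := alpha_simple; have [PP _ _] := Pos_pos.
by have /fsubsetP := PP; apply.
Qed.

Lemma root_neq0 v : v \in Phi -> v != 0.
Proof. by have [P0 _ _ _] := Phi_root; apply: contraTneq => ->. Qed.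

Lemma alpha_neq0 i : alpha i != 0. Proof. exact/root_neq0/alpha_Phi. Qed.

Lemma alphaE i : alpha i = \sum_j (j == i)%:R *: alpha j.
Proof.
rewrite (bigD1 i) //= eqxx scale1r big1 ?addr0 // => j /negbTE ->.
by rewrite scale0r.
Qed.

Lemma refl_root u v : u \in Phi -> v \in Phi -> v - cartan_int v u *: u \in Phi.
Proof. by move=> uP vP; rewrite -refl_mxE; have [_ _ h _] := Phi_root; apply: h. Qed.

Lemma root_sign v : v \in Phi -> exists k : 'I_l -> nat,
  v = \sum_i (k i)%:R *: alpha i \/ v = - \sum_i (k i)%:R *: alpha i.
Proof.
move=> vP; have [_ /(_ v vP) sgn _] := Pos_pos; have [_ _ h] := alpha_simple.
have [/h [k]|vN] := boolP (v \in Pos); first by rewrite subr0 => ->; exists k; left.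
move: sgn; rewrite (negbTE vN) /= => /h [k]; rewrite subr0 => E.
by exists k; right; rewrite -E opprK.
Qed.

Lemma root_coef_ge0 (k : 'I_l -> R) j : \sum_i k i *: alpha i \in Phi -> 0 < k j ->
  forall i, 0 <= k i.
Proof.
move=> kP kj i; case: (root_sign kP) => n [|] E.
  by rewrite (alpha_inj E) ler0n.
have {}E : \sum_i k i *: alpha i = \sum_i (- (n i)%:R) *: alpha i.
  by rewrite E -sumrN; apply: eq_bigr => a _; rewrite scaleNr.
by move: kj; rewrite (alpha_inj E) oppr_gt0 ltrn0.
Qed.

(** Reflecting [alpha i] in [alpha j] keeps the coefficient 1 at [i], so the coefficient at [j], the
    negated Cartan integer, cannot be negative. *)
Lemma cartan_int_le0 i j : i != j -> cartan_int (alpha i) (alpha j) <= 0.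
Proof.
move=> ij; pose a := cartan_int (alpha i) (alpha j).
have := refl_root (alpha_Phi j) (alpha_Phi i); rewrite -/a {1}alphaE [X in a *: X]alphaE.
rewrite scaler_sumr -sumrB; under eq_bigr => s _ do rewrite scalerA -scalerBl.
move=> /(@root_coef_ge0 _ i); rewrite eqxx (negbTE ij) mulr0 subr0 ltr01.
by move=> /(_ isT j); rewrite eqxx eq_sym (negbTE ij) mulr1 sub0r oppr_ge0.
Qed.

(** The value 0 on the diagonal removes loops from the graph and lets sums over neighbours run over
    all indices. Truncation is exact because the Cartan integers are integers of known sign. *)
Definition cartan_nat (i j : 'I_l) : nat :=
  if i == j then 0%N else Num.truncn (- cartan_int (alpha i) (alpha j)).

Lemma cartan_natE i j : cartan_int (alpha i) (alpha j) =
  if i == j then 2 else - (cartan_nat i j)%:R.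
Proof.
rewrite /cartan_nat; case: eqVneq => [->|ij]; first by rewrite cartan_intvv ?alpha_neq0.
rewrite truncnK ?opprK // natrEint rpredN Phi_crys ?alpha_Phi //=.
by rewrite oppr_ge0 cartan_int_le0.
Qed.

Lemma cartan_nat_diag i : cartan_nat i i = 0%N.
Proof. by rewrite /cartan_nat eqxx. Qed.

Lemma cartan_nat_adjC : symmetric (adj cartan_nat).
Proof.
move=> i j; case: (eqVneq i j) => [->//|ij].
have zero a b : a != b -> adj cartan_nat a b = (dotv (alpha a) (alpha b) != 0).
  move=> ab; have := cartan_int_dotv (alpha a) (alpha_neq0 b).
  rewrite cartan_natE (negbTE ab) /adj => E; apply/idP/idP.
    rewrite lt0n; apply: contra => /eqP d0; move: E; rewrite d0 mulr0 => /eqP.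
    rewrite mulf_eq0 oppr_eq0 pnatr_eq0 => /orP[//|].
    by rewrite gt_eqF // dotv_gt0 // alpha_neq0.
  rewrite lt0n; apply: contra => /eqP c0; move: E; rewrite c0 oppr0 mul0r => /esym/eqP.
  by rewrite mulf_eq0 pnatr_eq0.
have ji : j != i by rewrite eq_sym.
by rewrite (zero i j) // (zero j i) // (dotvC (alpha i)).
Qed.

Definition nat_comb (w : 'I_l -> nat) : 'cV[R]_l := \sum_i (w i)%:R *: alpha i.

Lemma cartan_int_nat_comb w t : cartan_int (nat_comb w) (alpha t) =
  2 * (w t)%:R - (\sum_s w s * cartan_nat s t)%N%:R.
Proof.
rewrite cartan_int_suml (bigD1 t) //= cartan_natE eqxx mulrC; congr (_ + _).
rewrite [in RHS](bigD1 t) //= cartan_nat_diag muln0 add0n natr_sum -sumrN.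
by apply: eq_bigr => s st; rewrite cartan_natE (negbTE st) mulrN natrM.
Qed.

(** The hypothesis says that [nat_comb w] has nonpositive product with every simple root in its
    support, hence with itself. *)
Lemma cartan_nat_finite (w : 'I_l -> nat) :
  (forall t, 0 < w t -> 2 * w t <= \sum_s w s * cartan_nat s t)%N -> forall t, w t = 0%N.
Proof.
move=> hw; suff v0 : nat_comb w = 0.
  by move=> t; apply/eqP; rewrite -(pnatr_eq0 R); apply/eqP; move: t; apply: alpha_free.
apply/eqP; apply: contraT => /dotv_gt0; apply: contraTT => _; rewrite -leNgt.
rewrite {1}/nat_comb dotv_suml sumr_le0 // => t _; rewrite dotvZl dotvC.
case: (posnP (w t)) => [->|wt]; first by rewrite mul0r.
rewrite mulr_ge0_le0 //; have := cartan_int_dotv (nat_comb w) (alpha_neq0 t).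
rewrite cartan_int_nat_comb -natrM => E.
have : (2 * w t)%N%:R - (\sum_s w s * cartan_nat s t)%N%:R <= 0 :> R.
  by rewrite subr_le0 ler_nat hw.
have := dotv_gt0 (alpha_neq0 t); move: E; nra.
Qed.

(** The subtraction on [nat] is exact for a root with a positive coefficient away from [t]: its
    reflection is again a positive root. *)
Definition refl_coef (w : 'I_l -> nat) t : 'I_l -> nat :=
  fun s => if s == t then (\sum_r w r * cartan_nat r t - w t)%N else w s.

Lemma refl_nat_comb w t j : nat_comb w \in Phi -> j != t -> (0 < w j)%N ->
  (w t <= \sum_s w s * cartan_nat s t)%N /\ nat_comb (refl_coef w t) \in Phi.
Proof.
move=> wP jt wj; set S := (\sum_s _)%N.
pose k s : R := if s == t then S%:R - (w t)%:R else (w s)%:R.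
have kE : nat_comb w - cartan_int (nat_comb w) (alpha t) *: alpha t = \sum_s k s *: alpha s.
  rewrite cartan_int_nat_comb -/S /nat_comb (bigD1 t) //= [RHS](bigD1 t) //= addrAC.
  rewrite -scalerBl /k eqxx; congr (_ *: _ + _); first by ring.
  by apply: eq_bigr => s /negbTE ->.
have kP := refl_root (alpha_Phi t) wP; rewrite kE in kP.
have /(_ t) : forall i, 0 <= k i.
  by apply: (root_coef_ge0 (j := j) kP); rewrite /k (negbTE jt) ltr0n.
rewrite /k eqxx subr_ge0 ler_nat => wS; split=> //.
suff -> : nat_comb (refl_coef w t) = \sum_s k s *: alpha s by [].
apply: eq_bigr => s _; rewrite /refl_coef /k -/S.
by case: ifP => // _; rewrite natrB.
Qed.

Variable c : 'I_l -> nat.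
Hypothesis c_highest : is_highest_root Phi alpha (nat_comb c).

Lemma highest_root_ge w : nat_comb w \in Phi -> forall t, (w t <= c t)%N.
Proof.
move=> wP t; have [_ /(_ _ wP) [k]] := c_highest.
move/eqP; rewrite subr_eq -big_split /= => /eqP.
under [in RHS]eq_bigr => i _ do rewrite -scalerDl.
by move/alpha_inj => /(_ t); rewrite -natrD => /eqP; rewrite eqr_nat; lia.
Qed.

Lemma nat_comb_alpha i : nat_comb (fun j => j == i) = alpha i.
Proof. by rewrite [RHS]alphaE. Qed.

Lemma highest_root_gt0 t : (0 < c t)%N.
Proof.
have := @highest_root_ge (fun j => j == t); rewrite nat_comb_alpha alpha_Phi.
by move=> /(_ isT t); rewrite eqxx.
Qed.

(** The reflected highest root lies below the highest root and differs from it by the corresponding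
    Cartan integer times [alpha t]. *)
Lemma highest_root_dominant t : (\sum_s c s * cartan_nat s t <= 2 * c t)%N.
Proof.
have [cP cmax] := c_highest.
have [k] := cmax _ (refl_root (alpha_Phi t) cP).
set K := cartan_int _ _; rewrite opprB addrCA subrr addr0 (alphaE t) scaler_sumr.
rewrite (eq_bigr (fun i => (K * (i == t)%:R) *: alpha i)) => [|i _]; last by rewrite scalerA.
move/alpha_inj => /(_ t); rewrite eqxx mulr1 /K cartan_int_nat_comb -natrM => E.
by rewrite -(ler_nat R) -subr_ge0 E.
Qed.

Lemma double_edge_coef s t : s != t -> (cartan_nat s t <= c t)%N.
Proof.
move=> st; have := @refl_nat_comb (fun j => j == s) t s.
rewrite nat_comb_alpha alpha_Phi eqxx => /(_ isT st isT) [_ /highest_root_ge /(_ t)].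
rewrite /refl_coef eqxx (eq_sym t) (negbTE st) subn0; apply: leq_trans.
by rewrite (bigD1 s) //= eqxx mul1n leq_addr.
Qed.

(* A root supported on both sides of an edgeless cut could be lowered by simple reflections
   for ever; the highest root is such a root. *)
Lemma cartan_nat_connected (J : {set 'I_l}) : J != set0 -> J != setT ->
  exists s t, [/\ s \in J, t \notin J & adj cartan_nat s t].
Proof.
move=> /set0Pn[i0 i0J]; rewrite -subTset => /subsetPn[j0 _ j0J].
suff /existsP[s /existsP[t /and3P[]]] :
  [exists s, exists t, [&& s \in J, t \notin J & adj cartan_nat s t]] by exists s, t.
apply: contraT => cut.
have N0 s t : s \in J -> t \notin J -> cartan_nat s t = 0%N /\ cartan_nat t s = 0%N.
  move=> sJ tJ; have h : ~~ adj cartan_nat s t.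
    by apply: contra cut => st; apply/existsP; exists s; apply/existsP; exists t; rewrite sJ tJ.
  by have := h; rewrite cartan_nat_adjC; move: h; rewrite /adj; lia.
have descent n w : (\sum_s w s < n)%N -> nat_comb w \in Phi ->
    (exists2 i, i \in J & 0 < w i)%N -> (exists2 j, j \notin J & 0 < w j)%N -> False.
  elim: n w => // n IH w wn wP [i iJ wi] [j jJ wj].
  have [t tJ wt] : exists2 t, t \in J &
      ((0 < w t) && (\sum_s w s * cartan_nat s t < 2 * w t))%N.
    apply/exists_inP; apply: contraT => /exists_inPn h.
    (* Without such a [t] the restriction of [w] to [J] would meet the hypothesis of
       [cartan_nat_finite] and vanish, since vertices outside [J] contribute nothing inside. *)
    pose w' s := if s \in J then w s else 0%N.
    suff : w' i = 0%N by rewrite /w' iJ; move: wi; lia.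
    apply: cartan_nat_finite => t; rewrite {1 2}/w'; case: ifP => // tJ wt.
    have := h t tJ; rewrite wt /= -leqNgt => /leq_trans; apply.
    apply: leq_sum => s _; rewrite /w'; case: ifP => // /negbT sJ.
    by rewrite (N0 t s tJ sJ).2 muln0.
  have /andP[wt0 wt1] := wt.
  have jt : j != t by apply: contraNneq jJ => ->.
  have [wtS w'P] := refl_nat_comb wP jt wj.
  apply: (IH _ _ w'P); last by exists j; rewrite // /refl_coef (negbTE jt).
    rewrite ltnS in wn; apply: leq_trans wn.
    rewrite (bigD1 t) //= [X in (_ < X)%N](bigD1 t) //= /refl_coef eqxx.
    rewrite -addSn leq_add //; first by lia.
    by apply: leq_sum => s /negbTE ->.
  (* If the new coefficient at [t] is zero, the positive sum equal to [w t] reveals another vertex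
     of [J] in the support. *)
  have [E|] := eqVneq (\sum_s w s * cartan_nat s t)%N (w t); last first.
    by move=> ne; exists t; rewrite // /refl_coef eqxx; lia.
  have [s sJ ws] : exists2 s, s \in J & ((0 < w s) && (s != t))%N.
    apply/exists_inP; apply: contraT => /exists_inPn h; move: wt0; rewrite -E big1 // => s _.
    case: (boolP (s \in J)) => sJ; last by rewrite (N0 t s tJ sJ).2 muln0.
    have := h s sJ; rewrite negb_and negbK => /orP[|/eqP ->]; last by rewrite cartan_nat_diag muln0.
    by rewrite lt0n negbK => /eqP ->.
  by have /andP[? /negbTE st] := ws; exists s; rewrite // /refl_coef st.
have [cP _] := c_highest.
case: (descent _ c (ltnSn _) cP); first by exists i0; rewrite // highest_root_gt0.
by exists j0; rewrite // highest_root_gt0.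
Qed.

End SimpleSystem.

(** * Second exponent and highest root by type *)

Lemma horner_char_poly (F : comNzRingType) n (A : 'M[F]_n) z :
  (char_poly A).[z] = \det (z%:M - A).
Proof.
rewrite -[LHS]horner_evalE -det_map_mx; congr (\det _).
by apply/matrixP => i j; rewrite !mxE /= horner_evalE !hornerE hornerMn hornerX.
Qed.

(** * The Coxeter element in the basis of simple roots *)

Section CoxeterElement.

Variables (R : realType) (l : nat) (Phi Pos : {fset 'cV[R]_l}) (alpha : 'I_l -> 'cV[R]_l).
Hypotheses (Phi_root : is_root_system Phi) (Phi_crys : crystallographic Phi).
Hypotheses (Pos_pos : is_positive_system Phi Pos) (alpha_simple : is_simple_system Pos alpha).

Let N := cartan_nat alpha.

(** The indices of [N] are exchanged because the image of [alpha j] under a simple reflection stands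
    in column [j]. *)
Definition coxeter_det (z : R[i]) : R[i] :=
  \det (coxeter_pencil (\matrix_(i, j) if i == j then 2 else - (N j i)%:R) z).

Lemma refl_mx_alpha i : let L := \matrix_(i, j) alpha j i 0 in
  refl_mx (alpha i) *m L = L *m pseudo_refl (\matrix_(i, j) cartan_int (alpha j) (alpha i)) i.
Proof.
apply/matrixP => a j; set L := \matrix_(_, _) _; set B := \matrix_(_, _) _.
have -> : (refl_mx (alpha i) *m L) a j = (refl_mx (alpha i) *m alpha j) a 0.
  by rewrite !mxE; apply: eq_bigr => b _; rewrite [L b j]mxE.
rewrite refl_mxE mulmxBr mulmx1 !mxE (bigD1 i) //= !mxE eqxx mulr1n.
rewrite big1 ?addr0 => [|k /negbTE ki]; first by rewrite mulrC.
by rewrite !mxE ki mulr0n mulr0.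
Qed.

Lemma coxeter_mx_alpha : let L := \matrix_(i, j) alpha j i 0 in
  coxeter_mx alpha *m L =
  L *m \prod_(i < l) pseudo_refl (\matrix_(i, j) cartan_int (alpha j) (alpha i)) i.
Proof.
move=> L; rewrite /coxeter_mx; elim/big_rec2: _ => [|i X Y _ IH].
  by rewrite mulmx1 mul1mx.
by rewrite -mulmxA IH mulmxA refl_mx_alpha -mulmxA.
Qed.

Lemma horner_char_poly_coxeter z :
  (char_poly (map_mx (real_complex R) (coxeter_mx alpha))).[z] = coxeter_det z.
Proof.
pose L : 'M[R]_l := \matrix_(i, j) alpha j i 0.
pose B : 'M[R]_l := \matrix_(i, j) cartan_int (alpha j) (alpha i).
have L0 : \det (map_mx (real_complex R) L) != 0.
  rewrite det_map_mx fmorph_eq0 -det_tr; apply/det0P => -[v v0 vL].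
  case/negP: v0; apply/eqP/rowP => i; rewrite mxE.
  apply: (alpha_free alpha_simple (k := v 0)).
  apply/colP => j; move/rowP/(_ j): vL; rewrite !mxE summxE => vL; rewrite -[RHS]vL.
  by apply: eq_bigr => k _; rewrite !mxE.
rewrite horner_char_poly.
have -> : coxeter_det z = \det (z%:M - \prod_(i < l) pseudo_refl (map_mx (real_complex R) B) i).
  rewrite det_prod_pseudo_refl => [|i]; last first.
    by rewrite !mxE cartan_intvv ?rmorph_nat ?(alpha_neq0 Phi_root Pos_pos alpha_simple).
  congr (\det (coxeter_pencil _ z)); apply/matrixP => i j; rewrite !mxE.
  rewrite (cartan_natE Phi_root Phi_crys Pos_pos alpha_simple) eq_sym.
  by case: eqVneq => _; rewrite ?rmorphN rmorph_nat.
apply: (mulIf L0); rewrite [RHS]mulrC -!det_mulmx mulmxBl mulmxBr scalar_mxC.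
congr (\det (_ - _)); rewrite -map_mxM coxeter_mx_alpha map_mxM; congr (_ *m _).
have mapP (r : seq 'I_l) : map_mx (real_complex R) (\prod_(i <- r) pseudo_refl B i) =
    \prod_(i <- r) pseudo_refl (map_mx (real_complex R) B) i.
  elim/big_ind2: _ => [|X X' Y Y' <- <-|i _]; first exact: map_mx1.
    by rewrite map_mxM.
  rewrite /pseudo_refl map_mxB map_mx1; congr (_ - _); apply/matrixP => a b.
  by rewrite !mxE raddfMn.
exact: mapP.
Qed.

Variables (z : R[i]).
Let M := coxeter_pencil (\matrix_(i, j) if i == j then 2 else - (N j i)%:R) z.

Lemma pencil_diag i : M i i = z + 1.
Proof. by rewrite mxE eqxx. Qed.

Lemma pencil_adj i j : ~~ adj N i j -> i != j -> M i j = 0.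
Proof.
rewrite (cartan_nat_adjC Phi_root Phi_crys Pos_pos alpha_simple) /adj -eqn0Ngt.
move=> /eqP Nji /negbTE ij.
by rewrite !mxE ij /N Nji oppr0 mulr0; case: ifP.
Qed.

Lemma pencil_mult i j : i != j -> M i j * M j i = z * (mult N i j)%:R.
Proof.
move=> ij; have ji : j != i by rewrite eq_sym.
rewrite !mxE (negbTE ij) (negbTE ji) /mult natrM.
by case: (ltngtP i j) ij => [| |/val_inj ->]; rewrite ?eqxx // => _ _; ring.
Qed.

End CoxeterElement.

(** * Bounds for each type *)

Section SecondExponent.

Variables (R : realType) (l : nat) (l_ge2 : (2 <= l)%N) (Phi Pos : {fset 'cV[R]_l}).
Variable alpha : 'I_l -> 'cV[R]_l.
Hypotheses (Phi_root : is_root_system Phi) (Phi_crys : crystallographic Phi).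
Hypotheses (Pos_pos : is_positive_system Phi Pos) (alpha_simple : is_simple_system Pos alpha).
Variable c : 'I_l -> nat.
Hypothesis c_highest : is_highest_root Phi alpha (nat_comb alpha c).
Variable m : l.-tuple nat.
Hypothesis m_exp : is_exponents alpha m.

Let N := cartan_nat alpha.
Let m2 := tnth m (Ordinal l_ge2).
Let adjC : symmetric (adj N) := cartan_nat_adjC Phi_root Phi_crys Pos_pos alpha_simple.
Let Ndiag x : N x x = 0%N := cartan_nat_diag alpha x.

Lemma cartan_nat_shape : finite_shape N.
Proof.
apply: (finite_type_shape Ndiag adjC).
- exact: (cartan_nat_finite Phi_root Phi_crys Pos_pos alpha_simple).
- exact: (cartan_nat_connected Phi_root Phi_crys Pos_pos alpha_simple c_highest).
- by rewrite card_ord.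
Qed.

(** The two required eigenvalues are described only by which of their powers equal 1, so that each
    type is left with polynomial identities instead of trigonometry. *)
Lemma second_exponent_bound H k : (1 < k < H)%N ->
  (forall z, coxeter_det alpha z = 0 -> z ^+ H = 1) ->
  (forall w j, (j == 1%N) || (j == k) ->
    (forall a, (w ^+ a == 1) = (H %| j * a)%N) -> coxeter_det alpha w = 0) ->
  (m2 <= k)%N.
Proof.
move=> kH rootH rootk; have [h [ord ms mlt pE]] := m_exp.
have H0 : (0 < H)%N by lia.
have rE z : root (char_poly (map_mx (real_complex R) (coxeter_mx alpha))) z =
    (coxeter_det alpha z == 0).
  by rewrite /root (horner_char_poly_coxeter Phi_root Phi_crys Pos_pos alpha_simple).
have root_expi j : (j == 1%N) || (j == k) ->
    coxeter_det alpha (expi (2 * pi * j%:R / H%:R)) = 0.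
  by move=> jk; apply: (rootk _ j jk) => a; rewrite expi_fracX expi_frac_eq1.
apply: (second_exponent_le ord mlt pE H0) => //.
- by move=> z; rewrite rE => /eqP /rootH.
- by have := root_expi 1%N isT; rewrite rE mulr1 => ->.
- by rewrite rE root_expi ?eqxx ?orbT.
Qed.

Lemma pow_eqN1 (w : R[i]) H j a : (forall a, (w ^+ a == 1) = (H %| j * a)%N) ->
  (H %| j * (a + a))%N -> ~~ (H %| j * a)%N -> w ^+ a = -1.
Proof.
move=> wH H2 H1; apply/eqP; rewrite -subr_eq0 opprK; apply/eqP.
have w1 : w ^+ a - 1 != 0 by rewrite subr_eq0 wH.
apply: (mulfI w1); rewrite mulr0 -subr_sqr_1 -exprM muln2 -addnn.
by apply/eqP; rewrite subr_eq0 wH.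
Qed.

Lemma neq_powN1 (w : R[i]) H j a : (forall a, (w ^+ a == 1) = (H %| j * a)%N) ->
  ~~ (H %| j * (a + a))%N -> w ^+ a + 1 != 0.
Proof.
move=> wH; apply: contra; rewrite addr_eq0 => /eqP wa.
by rewrite -wH exprD wa mulrNN mulr1.
Qed.

Lemma pow_eq1_of_factor (p z q : R[i]) H : z ^+ H - 1 = p * q -> p = 0 -> z ^+ H = 1.
Proof. by move=> E p0; apply/eqP; rewrite -subr_eq0 E p0 mul0r. Qed.

Lemma coef_max t : (c t <= c_max c)%N.
Proof. exact: leq_bigmax. Qed.

Let pdiag z := @pencil_diag R l alpha z.
Let padj z := @pencil_adj _ _ _ _ _ Phi_root Phi_crys Pos_pos alpha_simple z.
Let pmult z := @pencil_mult R l alpha z.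

Lemma coxeter_det_path z n x : induced_path N n x -> covers n x ->
  coxeter_det alpha z =
  path_minor (coxeter_pencil (\matrix_(i, j) if i == j then 2 else - (N j i)%:R) z) x n.
Proof.
move=> Px cx; rewrite /path_minor seq_minorT // => t; case: (cx t) => i ni ->.
by apply: map_f; rewrite mem_iota.
Qed.

Lemma second_exponent_typeA n x : induced_path N n x -> covers n x ->
  (forall i, (i.+1 < n)%N -> mult N (x i) (x i.+1) = 1%N) -> (m2 <= 2)%N.
Proof.
move=> Px cx m1; have nl : n = l by rewrite -(card_covers Px cx) card_ord.
have dE z : (z - 1) * coxeter_det alpha z = z ^+ n.+1 - 1.
  by rewrite (coxeter_det_path z Px cx)
    (path_minor_typeA adjC (@pdiag z) (@padj z) (@pmult z) Px m1).
apply: (@second_exponent_bound n.+1 2) => [|z z0|w j jk wH]; first by rewrite nl ltnS.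
  by have := dE z; rewrite z0 mulr0 => /esym/eqP; rewrite subr_eq0 => /eqP.
have w1 : w - 1 != 0.
  rewrite subr_eq0 -[w]expr1 wH muln1; apply/negP => /dvdn_leq.
  by case/orP: jk => /eqP ->; lia.
by apply: (mulfI w1); rewrite mulr0 dE; apply/eqP; rewrite subr_eq0 wH dvdn_mull.
Qed.

Lemma odd_half_turn (n j : nat) : (0 < n)%N -> odd j ->
  (n.*2 %| j * (n + n))%N /\ ~~ (n.*2 %| j * n)%N.
Proof.
move=> n0 jo; rewrite addnn dvdn_mull //; split=> //.
by rewrite -mul2n dvdn_pmul2r // dvdn2 jo.
Qed.

(** Types B and C are treated together: the roots of [z ^+ n + 1] give the exponents 1 and 3 for H =
    2n, and the double edge, in whichever direction, forces a coefficient 2. *)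
Lemma second_exponent_typeB n x : induced_path N n x -> covers n x -> (1 < n)%N ->
  mult N (x 0%N) (x 1%N) = 2%N ->
  (forall i, (0 < i)%N -> (i.+1 < n)%N -> mult N (x i) (x i.+1) = 1%N) -> (m2 <= (c_max c).+1)%N.
Proof.
move=> Px cx n1 m0 m1; have nl : n = l by rewrite -(card_covers Px cx) card_ord.
have dE z : coxeter_det alpha z = z ^+ n + 1.
  by rewrite (coxeter_det_path z Px cx) -[n in path_minor _ _ n](prednK (ltnW n1))
    (path_minor_typeB adjC (@pdiag z) (@padj z) (@pmult z) Px m0 m1) prednK ?(ltnW n1).
have m3 : (m2 <= 3)%N.
  apply: (@second_exponent_bound n.*2 3) => [|z|w j jk wH]; first by lia.
    rewrite dE => /eqP; rewrite addr_eq0 => /eqP zn.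
    by rewrite -addnn exprD zn mulrNN mulr1.
  have jo : odd j by case/orP: jk => /eqP ->.
  have [h1 h2] := odd_half_turn (ltnW n1) jo.
  by rewrite dE (pow_eqN1 wH h1 h2) addNr.
apply: leq_trans m3 _; rewrite ltnS.
have x01 : x 0%N != x 1%N.
  by case: Px => inj _ _; apply/eqP => /(inj _ _ (ltnW n1) n1).
have h01 := double_edge_coef Phi_root Phi_crys Pos_pos alpha_simple c_highest x01.
rewrite eq_sym in x01.
have h10 := double_edge_coef Phi_root Phi_crys Pos_pos alpha_simple c_highest x01.
have := coef_max (x 0%N); have := coef_max (x 1%N); move: m0 h01 h10; rewrite /mult /N.
by move: (cartan_nat _ _ _) (cartan_nat _ _ _) => [|[|[|a]]] [|[|[|b]]]; lia.
Qed.

(** Dominance weakened to some of the neighbours, each counted once; this makes it linear in the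
    coefficients. *)
Lemma dominant_seq q t : uniq q -> all (adj N t) q -> (\sum_(s <- q) c s <= 2 * c t)%N.
Proof.
move=> uq /allP aq.
apply: leq_trans (highest_root_dominant Phi_root Phi_crys Pos_pos alpha_simple c_highest t).
rewrite [X in (_ <= X)%N](bigID (mem q)) /= -big_uniq //=.
apply: leq_trans (leq_addr _ _); rewrite !big_seq; apply: leq_sum => s sq.
by rewrite leq_pmulr //; have := aq s sq; rewrite adjC.
Qed.

Section Branch.

Variables (n : nat) (x : nat -> 'I_l) (v : 'I_l) (i : nat).
Hypotheses (Px : induced_path N n x) (vx : off_path n x v).
Hypothesis cov : forall t, t != v -> exists2 j, (j < n)%N & t = x j.
Hypothesis vadj : forall j, (j < n)%N -> adj N v (x j) = (j == i).
Hypothesis mv : mult N v (x i) = 1%N.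
Hypothesis m1 : forall k, (k.+1 < n)%N -> mult N (x k) (x k.+1) = 1%N.
Hypothesis i1 : (i.+1 < n)%N.

Let edge k : (k.+1 < n)%N -> adj N (x k) (x k.+1).
Proof. by case: Px => _ h _; apply: h. Qed.

Let uniq_x s : uniq s -> (forall a, a \in s -> a < n)%N -> uniq (map x s).
Proof. exact: (uniq_map_path Px). Qed.

Lemma coxeter_det_branch z : coxeter_det alpha z =
  branch_minor (coxeter_pencil (\matrix_(i, j) if i == j then 2 else - (N j i)%:R) z) x v n.
Proof.
rewrite /branch_minor seq_minorT // => t; rewrite inE; case: eqVneq => //= /cov[k nk ->].
by apply: map_f; rewrite mem_iota.
Qed.

Lemma dominant_first : (0 < i)%N -> (c (x 1%N) <= 2 * c (x 0%N))%N.
Proof.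
move=> i0; have := @dominant_seq [:: x 1%N] (x 0%N); rewrite big_seq1; apply=> //=.
by rewrite edge //; lia.
Qed.

Lemma dominant_last k : k.+2 = n -> (c (x k) <= 2 * c (x k.+1))%N.
Proof.
move=> kn; have := @dominant_seq [:: x k] (x k.+1); rewrite big_seq1; apply=> //=.
by rewrite adjC edge // -kn.
Qed.

Lemma dominant_middle k : (k.+2 < n)%N -> (c (x k) + c (x k.+2) <= 2 * c (x k.+1))%N.
Proof.
move=> kn; have := @dominant_seq (map x [:: k; k.+2]) (x k.+1).
rewrite big_map !big_cons big_nil addn0; apply.
  by apply: uniq_x => [|a]; rewrite /= !inE; lia.
by rewrite /= adjC !edge // ltnW.
Qed.

Lemma dominant_branch : (0 < i)%N ->
  (c v + c (x i.-1) + c (x i.+1) <= 2 * c (x i))%N.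
Proof.
move=> i0; have := @dominant_seq (v :: map x [:: i.-1; i.+1]) (x i).
rewrite !big_cons big_nil addn0 addnA; apply.
  rewrite cons_uniq uniq_x ?andbT; first 1 last.
  - by rewrite /= !inE; lia.
  - by move=> a; rewrite !inE; lia.
  by rewrite !inE negb_or !vx //; lia.
rewrite /= adjC vadj ?eqxx ?edge //=; last exact: ltnW.
by rewrite andbT adjC -{2}(prednK i0) edge ?prednK // ltnW.
Qed.

Lemma dominant_leaf : (c (x i) <= 2 * c v)%N.
Proof.
have := @dominant_seq [:: x i] v; rewrite big_seq1; apply=> //=.
by rewrite vadj ?eqxx // ltnW.
Qed.

Let cpos t : (0 < c t)%N := highest_root_gt0 Pos_pos alpha_simple c_highest t.

Lemma second_exponent_typeD : i = 1%N -> (m2 <= (c_max c).+1)%N.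
Proof.
move=> iE; have n2 : (2 < n)%N by move: i1; rewrite iE.
have dE z : coxeter_det alpha z = (z + 1) * (z ^+ n + 1).
  by rewrite coxeter_det_branch -(prednK (ltnW (ltnW n2)))
    (branch_minor_typeD adjC (@pdiag z) (@padj z) (@pmult z) Px vx (ltnW i1) vadj mv m1 iE)
    ?prednK ?(ltnW (ltnW n2)).
have m3 : (m2 <= 3)%N.
  apply: (@second_exponent_bound n.*2 3) => [|z|w j jk wH]; first by lia.
    rewrite dE => /eqP; rewrite mulf_eq0 !addr_eq0 => /orP[] /eqP zn.
      by rewrite zn -mul2n exprM sqrrN !expr1n.
    by rewrite -addnn exprD zn mulrNN mulr1.
  have jo : odd j by case/orP: jk => /eqP ->.
  have [h1 h2] := odd_half_turn (ltnW (ltnW n2)) jo.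
  by rewrite dE (pow_eqN1 wH h1 h2) addNr mulr0.
apply: leq_trans m3 _; rewrite ltnS; apply: leq_trans (coef_max (x i)).
have := dominant_branch; rewrite iE => /(_ isT).
by have := cpos v; have := cpos (x 0%N); have := cpos (x 2%N); rewrite /=; lia.
Qed.

(** Along an arm with r vertices dominance makes the coefficient next to the branch at least r/(r+1)
    of the one at the branch. For the arms 1, 2 and [n - 3], rounding up in the inequality at the
    branch leaves no positive value there below 3, 4, 6 in the three cases. *)
Lemma second_exponent_typeE : i = 2%N -> (4 < n < 8)%N -> (m2 <= (c_max c).+1)%N.
Proof.
move=> iE /andP[n4 n8].
have E z := branch_minor_typeE adjC (@pdiag z) (@padj z) (@pmult z) Px vx
  (ltnW i1) vadj mv m1 iE n4.
have d0 : (c (x 1%N) <= 2 * c (x 0%N))%N by apply: dominant_first; rewrite iE.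
have dv := dominant_leaf; have d2 := dominant_branch; rewrite iE /= in dv d2.
have {}d2 := d2 isT.
have d1 := dominant_middle (k := 0%N); have d3 := dominant_middle (k := 2%N).
have d4 := dominant_middle (k := 3%N); have d5 := dominant_middle (k := 4%N).
have c0 := cpos v; have cx j := cpos (x j).
have cm := coef_max (x 2%N).
have : [\/ n = 5%N, n = 6%N | n = 7%N].
  by move: n4 n8; case: (n) => [|[|[|[|[|[|[|[|]]]]]]]] //; by constructor.
case=> nE.
- have m3 : (m2 <= 4)%N.
    have dE z : coxeter_det alpha z = (z ^+ 2 + z + 1) * (z ^+ 4 - z ^+ 2 + 1).
      by rewrite coxeter_det_branch nE; case: (E z).
    apply: (@second_exponent_bound 12 4) => [|z|w j jk wH]; first by [].
      (* The cofactor is the product of the cyclotomic polynomials of indices 1, 2, 4 and 6. *)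
      apply: (@pow_eq1_of_factor _ _ ((z - 1) * (z + 1) * (z ^+ 2 + 1) * (z ^+ 2 - z + 1))).
      by rewrite dE; ring.
    (* Here 4 is not prime to 12: for [j = 1] the root has order 12 and kills the quartic factor,
       for [j = 4] it has order 3 and kills the quadratic one. *)
    rewrite dE; case/orP: jk => /eqP jE; rewrite jE in wH.
      have h2 : w ^+ 2 + 1 != 0 by apply: (neq_powN1 wH).
      have h6 : w ^+ 6 = -1 by apply: (pow_eqN1 wH).
      apply: (mulfI h2); rewrite mulr0.
      transitivity ((w ^+ 2 + w + 1) * (w ^+ 6 + 1)); first by ring.
      by rewrite h6 addNr mulr0.
    have h1 : w - 1 != 0 by rewrite subr_eq0 -[w]expr1 wH.
    have h3 : w ^+ 3 = 1 by apply/eqP; rewrite wH.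
    apply: (mulfI h1); rewrite mulr0.
    transitivity ((w ^+ 3 - 1) * (w ^+ 4 - w ^+ 2 + 1)); first by ring.
    by rewrite h3 subrr mul0r.
  apply: leq_trans m3 _; have dl := dominant_last (k := 3%N); rewrite nE in d1 d3 d4 dl.
  move: (d1 isT) (d3 isT) (dl erefl) (cx 0%N) (cx 1%N) (cx 2%N) (cx 3%N) (cx 4%N).
  by clear -c0 cm d0 d2 dv; lia.
- have m3 : (m2 <= 5)%N.
    have dE z : coxeter_det alpha z = (z + 1) * (z ^+ 6 - z ^+ 3 + 1).
      by rewrite coxeter_det_branch nE; case: (E z) => _ -> //; rewrite nE.
    apply: (@second_exponent_bound 18 5) => [|z|w j jk wH]; first by [].
      apply: (@pow_eq1_of_factor _ _ ((z ^+ 9 - 1) * (z ^+ 2 - z + 1))).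
      by rewrite dE; ring.
    have h3 : w ^+ 3 + 1 != 0 by apply: (neq_powN1 wH); case/orP: jk => /eqP ->.
    have h9 : w ^+ 9 = -1 by apply: (pow_eqN1 wH); case/orP: jk => /eqP ->.
    apply: (mulfI h3); rewrite mulr0 dE.
    transitivity ((w + 1) * (w ^+ 9 + 1)); first by ring.
    by rewrite h9 addNr mulr0.
  apply: leq_trans m3 _; have dl := dominant_last (k := 4%N); rewrite nE in d1 d3 d4 d5 dl.
  move: (d1 isT) (d3 isT) (d4 isT) (dl erefl) (cx 0%N) (cx 1%N) (cx 2%N) (cx 3%N) (cx 4%N) (cx 5%N).
  by clear -c0 cm d0 d2 dv; lia.
- have m3 : (m2 <= 7)%N.
    have dE z : coxeter_det alpha z = z ^+ 8 + z ^+ 7 - z ^+ 5 - z ^+ 4 - z ^+ 3 + z + 1.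
      by rewrite coxeter_det_branch nE; case: (E z) => _ _ -> //; rewrite nE.
    apply: (@second_exponent_bound 30 7) => [|z|w j jk wH]; first by [].
      apply: (@pow_eq1_of_factor _ _ ((z ^+ 15 - 1) *
        ((z + 1) * (z ^+ 2 - z + 1) * (z ^+ 4 - z ^+ 3 + z ^+ 2 - z + 1)))).
      by rewrite dE; ring.
    have h3 : w ^+ 3 + 1 != 0 by apply: (neq_powN1 wH); case/orP: jk => /eqP ->.
    have h5 : w ^+ 5 + 1 != 0 by apply: (neq_powN1 wH); case/orP: jk => /eqP ->.
    have h15 : w ^+ 15 = -1 by apply: (pow_eqN1 wH); case/orP: jk => /eqP ->.
    (* The factor of index 30 is isolated by (w^3 + 1)(w^5 + 1) F(w) = (w + 1)(w^15 + 1). *)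
    apply: (mulfI h3); apply: (mulfI h5); rewrite !mulr0 dE.
    transitivity ((w + 1) * (w ^+ 15 + 1)); first by ring.
    by rewrite h15 addNr mulr0.
  apply: leq_trans m3 _; have dl := dominant_last (k := 5%N); rewrite nE in d1 d3 d4 d5 dl.
  move: (d1 isT) (d3 isT) (d4 isT) (d5 isT) (dl erefl).
  move: (cx 0%N) (cx 1%N) (cx 2%N) (cx 3%N) (cx 4%N) (cx 5%N) (cx 6%N).
  by clear -c0 cm d0 d2 dv; lia.
Qed.

End Branch.

(** * Computing roots by successive reflections *)

Definition coef_seq (z : seq ('I_l * nat)) (s : 'I_l) : nat :=
  (\sum_(r <- z) r.2 * (r.1 == s))%N.

Lemma sum_coef_seq z t :
  (\sum_s coef_seq z s * N s t = \sum_(r <- z) r.2 * N r.1 t)%N.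
Proof.
under eq_bigr => s _ do rewrite big_distrl /=.
rewrite exchange_big; apply: eq_bigr => r _ /=.
rewrite (bigD1 r.1) //= eqxx muln1 big1 ?addn0 // => s sr.
by rewrite eq_sym (negbTE sr) muln0 mul0n.
Qed.

Lemma coef_seq_notin z t : t \notin unzip1 z -> coef_seq z t = 0%N.
Proof.
move=> tz; rewrite /coef_seq big_seq big1 // => r rz.
by case: eqP => [E|]; rewrite ?muln0 //; case/negP: tz; rewrite -E map_f.
Qed.

(** The entry [(j, k)] witnesses a positive coefficient away from [t], which keeps the reflected
    root positive and [S - a] exact. *)
Lemma refl_coef_seq z1 z2 t a j k : t \notin unzip1 (z1 ++ z2) -> (j, k) \in z1 ++ z2 ->
  (0 < k)%N -> nat_comb alpha (coef_seq (z1 ++ (t, a) :: z2)) \in Phi ->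
  let S := (\sum_(r <- z1 ++ z2) r.2 * N r.1 t)%N in
  (a <= S)%N /\ nat_comb alpha (coef_seq (z1 ++ (t, S - a)%N :: z2)) \in Phi.
Proof.
move=> tz jz k0 zP S; set z := z1 ++ (t, a) :: z2 in zP *.
have coefE b s : coef_seq (z1 ++ (t, b) :: z2) s = (b * (t == s) + coef_seq (z1 ++ z2) s)%N.
  by rewrite /coef_seq !big_cat big_cons /= addnCA.
have jt : j != t by apply: contraNneq tz => <-; exact: (map_f (@fst _ _) jz).
have wj : (0 < coef_seq z j)%N.
  by rewrite coefE /coef_seq (big_rem (j, k)) //= eqxx muln1; lia.
have wt b : coef_seq (z1 ++ (t, b) :: z2) t = b.
  by rewrite coefE eqxx muln1 coef_seq_notin ?addn0.
have sumE : (\sum_s coef_seq z s * N s t = S)%N.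
  by rewrite sum_coef_seq /z /S !big_cat big_cons /= Ndiag muln0.
have [] := refl_nat_comb Phi_root Phi_crys Pos_pos alpha_simple zP jt wj.
rewrite sumE wt => aS; split=> //.
suff -> : nat_comb alpha (coef_seq (z1 ++ (t, (S - a)%N) :: z2)) =
    nat_comb alpha (refl_coef alpha (coef_seq z) t) by [].
apply: eq_bigr => s _; congr (_%:R *: _); rewrite /refl_coef sumE.
case: eqVneq => [->|st]; first by rewrite !wt.
by rewrite !coefE eq_sym (negbTE st) !muln0.
Qed.

Lemma coef_seq_alpha z1 z2 t : (forall r, r \in z1 ++ z2 -> r.2 = 0%N) ->
  nat_comb alpha (coef_seq (z1 ++ (t, 1%N) :: z2)) \in Phi.
Proof.
move=> z0; rewrite (_ : nat_comb _ _ = alpha t); first exact: (alpha_Phi Pos_pos alpha_simple).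
rewrite -nat_comb_alpha; apply: eq_bigr => s _; congr (_%:R *: _).
have : (\sum_(r <- z1 ++ z2) r.2 * (r.1 == s) = 0)%N.
  by rewrite big_seq big1 // => r /z0 ->.
by rewrite /coef_seq !big_cat big_cons /= eq_sym; lia.
Qed.

Lemma coef_seq_le z r : nat_comb alpha (coef_seq z) \in Phi -> r \in z -> (r.2 <= c r.1)%N.
Proof.
move=> zP rz; apply: leq_trans (highest_root_ge alpha_simple c_highest zP r.1).
by rewrite /coef_seq (big_rem r) //= eqxx muln1 leq_addr.
Qed.

(* In type F4 the highest root has a coefficient one larger than the highest short root,
   which dominance alone does not exclude. *)
Lemma typeF_coef n x : induced_path N n x -> n = 4%N -> mult N (x 0%N) (x 1%N) = 1%N ->
  N (x 1%N) (x 2%N) = 2%N -> N (x 2%N) (x 1%N) = 1%N -> mult N (x 2%N) (x 3%N) = 1%N ->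
  (4 <= c (x 2%N))%N.
Proof.
move=> Px nE m0 N12 N21 m2'.
have N1 s t : mult N s t = 1%N -> N s t = 1%N /\ N t s = 1%N.
  by move/eqP; rewrite muln_eq1 => /andP[/eqP -> /eqP ->].
have [N01 N10] := N1 _ _ m0; have [N23 N32] := N1 _ _ m2'.
have chord i j : (i.+1 < j < n)%N -> N (x i) (x j) = 0%N /\ N (x j) (x i) = 0%N.
  case: Px => _ _ h ij; have := h i j ij; have := h i j ij.
  by rewrite {1}adjC /adj; lia.
have [N02 N20] : N (x 0%N) (x 2%N) = 0%N /\ N (x 2%N) (x 0%N) = 0%N by apply: chord; rewrite nE.
have [N13 N31] : N (x 1%N) (x 3%N) = 0%N /\ N (x 3%N) (x 1%N) = 0%N by apply: chord; rewrite nE.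
have [N03 N30] : N (x 0%N) (x 3%N) = 0%N /\ N (x 3%N) (x 0%N) = 0%N by apply: chord; rewrite nE.
have : uniq (map x [:: 0; 1; 2; 3]%N).
  by apply: (uniq_map_path Px) => // a; rewrite !inE nE; lia.
rewrite /= !inE !negb_or !andbT => /and3P[/and3P[x01 x02 x03] /andP[x12 x13] x23].
pose z (a b d e : nat) := [:: (x 0%N, a); (x 1%N, b); (x 2%N, d); (x 3%N, e)].
pose P a b d e := nat_comb alpha (coef_seq (z a b d e)) \in Phi.
(* The reflections climb through 0100, 0120, 0122, 1122, 1222 and 1242, where the coefficient 4
   appears. *)
have P0 : P 0%N 1%N 0%N 0%N.
  apply: (@coef_seq_alpha [:: (x 0%N, 0%N)] [:: (x 2%N, 0%N); (x 3%N, 0%N)]) => r.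
  by rewrite !inE => /or3P[] /eqP ->.
have P1 : P 0%N 1%N 2%N 0%N.
  have := @refl_coef_seq [:: (x 0%N, 0%N); (x 1%N, 1%N)] [:: (x 3%N, 0%N)] (x 2%N) 0%N (x 1%N) 1%N.
  rewrite /= !inE !negb_or ![x 2%N == _]eq_sym x02 x12 eq_sym x23 eqxx orbT.
  by move=> /(_ isT isT isT P0) [_]; rewrite !big_cons big_nil /= N12 N02 N32.
have P2 : P 0%N 1%N 2%N 2%N.
  have := @refl_coef_seq [:: (x 0%N, 0%N); (x 1%N, 1%N); (x 2%N, 2%N)] [::] (x 3%N) 0%N (x 1%N) 1%N.
  rewrite /= !inE !negb_or ![x 3%N == _]eq_sym x03 x13 x23 eqxx orbT.
  by move=> /(_ isT isT isT P1) [_]; rewrite !big_cons big_nil /= N13 N03 N23.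
have P3 : P 1%N 1%N 2%N 2%N.
  have := @refl_coef_seq [::] [:: (x 1%N, 1%N); (x 2%N, 2%N); (x 3%N, 2%N)] (x 0%N) 0%N (x 1%N) 1%N.
  rewrite /= !inE !negb_or x01 x02 x03 eqxx.
  by move=> /(_ isT isT isT P2) [_]; rewrite !big_cons big_nil /= N10 N20 N30.
have P4 : P 1%N 2%N 2%N 2%N.
  have := @refl_coef_seq [:: (x 0%N, 1%N)] [:: (x 2%N, 2%N); (x 3%N, 2%N)] (x 1%N) 1%N (x 0%N) 1%N.
  rewrite /= !inE !negb_or [x 1%N == x 0%N]eq_sym x01 x12 x13 eqxx.
  by move=> /(_ isT isT isT P3) [_]; rewrite !big_cons big_nil /= N01 N21 N31.
have P5 : P 1%N 2%N 4%N 2%N.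
  have := @refl_coef_seq [:: (x 0%N, 1%N); (x 1%N, 2%N)] [:: (x 3%N, 2%N)] (x 2%N) 2%N (x 0%N) 1%N.
  rewrite /= !inE !negb_or ![x 2%N == _]eq_sym x02 x12 eq_sym x23 eqxx.
  by move=> /(_ isT isT isT P4) [_]; rewrite !big_cons big_nil /= N02 N12 N32.
by apply: (coef_seq_le (r := (x 2%N, 4%N)) P5); rewrite !inE eqxx !orbT.
Qed.

Lemma second_exponent_typeF n x : induced_path N n x -> covers n x -> n = 4%N ->
  mult N (x 0%N) (x 1%N) = 1%N -> mult N (x 1%N) (x 2%N) = 2%N ->
  mult N (x 2%N) (x 3%N) = 1%N -> (m2 <= (c_max c).+1)%N.
Proof.
move=> Px cx nE m0 m1 m3.
have dE z : coxeter_det alpha z = z ^+ 4 - z ^+ 2 + 1.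
  rewrite (coxeter_det_path z Px cx).
  by rewrite -(path_minor_typeF adjC (@pdiag z) (@padj z) (@pmult z) Px nE m0 m1 m3) -nE.
have m5 : (m2 <= 5)%N.
  apply: (@second_exponent_bound 12 5) => [|z|w j jk wH]; first by [].
    apply: (@pow_eq1_of_factor _ _ ((z ^+ 6 - 1) * (z ^+ 2 + 1))).
    by rewrite dE; ring.
  have h2 : w ^+ 2 + 1 != 0 by apply: (neq_powN1 wH); case/orP: jk => /eqP ->.
  have h6 : w ^+ 6 = -1 by apply: (pow_eqN1 wH); case/orP: jk => /eqP ->.
  apply: (mulfI h2); rewrite mulr0 dE.
  transitivity (w ^+ 6 + 1); first by ring.
  by rewrite h6 addNr.
apply: leq_trans m5 _; rewrite ltnS.
have [[N12 N21]|[N12 N21]] : N (x 1%N) (x 2%N) = 2%N /\ N (x 2%N) (x 1%N) = 1%N \/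
    N (x 1%N) (x 2%N) = 1%N /\ N (x 2%N) (x 1%N) = 2%N.
- by move: m1; rewrite /mult; case: (N (x 1%N) _) => [|[|[|a]]]; lia.
- by apply: leq_trans (coef_max _); apply: (typeF_coef Px nE m0 N12 N21 m3).
(* The other direction of the double edge is the same diagram read from its far end. *)
have Px' := induced_path_rev adjC Px; apply: leq_trans (coef_max (x 1%N)).
have := typeF_coef Px' nE; rewrite nE /= !subn0 !subSS !subn0.
by rewrite multC N21 N12 [mult N (x 1%N) _]multC; apply.
Qed.

(** * Roots in rank two *)

Section RankTwo.

Variables (y0 y1 : 'I_l).
Hypotheses (y01 : y0 != y1) (cov2 : forall t, t = y0 \/ t = y1).

Definition root2 (a b : nat) : bool :=
  nat_comb alpha (coef_seq [:: (y0, a); (y1, b)]) \in Phi.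

Lemma nat_comb_pair w :
  nat_comb alpha w = nat_comb alpha (coef_seq [:: (y0, w y0); (y1, w y1)]).
Proof.
have y10 : y1 != y0 by rewrite eq_sym.
apply: eq_bigr => s _; congr (_%:R *: _); rewrite /coef_seq !big_cons big_nil addn0 /=.
by case: (cov2 s) => ->; rewrite eqxx ?(negbTE y01) ?(negbTE y10) ?muln0 ?muln1 ?addn0.
Qed.

Lemma nat_comb_pairE a b : nat_comb alpha (coef_seq [:: (y0, a); (y1, b)]) =
  a%:R *: alpha y0 + b%:R *: alpha y1.
Proof.
have y10 : y1 != y0 by rewrite eq_sym.
rewrite /nat_comb (bigD1 y0) //= (bigD1 y1) //= big1 ?addr0 => [|s /andP[/eqP s0 /eqP s1]].
  rewrite /coef_seq !big_cons !big_nil /= !eqxx (negbTE y01) (negbTE y10).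
  by rewrite !muln0 !muln1 !addn0.
by case: (cov2 s) => [/s0|/s1].
Qed.

Lemma root2_refl0 a b : root2 a b -> (0 < b)%N ->
  (a <= b * N y1 y0)%N /\ root2 (b * N y1 y0 - a) b.
Proof.
move=> ab b0; have := @refl_coef_seq [::] [:: (y1, b)] y0 a y1 b.
by rewrite /= !inE y01 eqxx !big_cons big_nil addn0 => /(_ isT isT b0 ab).
Qed.

Lemma root2_refl1 a b : root2 a b -> (0 < a)%N ->
  (b <= a * N y0 y1)%N /\ root2 a (a * N y0 y1 - b).
Proof.
move=> ab a0; have := @refl_coef_seq [:: (y0, a)] [::] y1 b y0 a.
by rewrite /= !inE eq_sym y01 eqxx !big_cons big_nil addn0 => /(_ isT isT a0 ab).
Qed.

Lemma root2_reduced k a b : root2 a b -> root2 (k * a) (k * b) -> k = 1%N.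
Proof.
rewrite /root2 !nat_comb_pairE !natrM -!scalerA -scalerDr.
have [_ _ _ red] := Phi_root; move=> ab /(red _ _ ab)[|] /eqP.
  by rewrite pnatr_eq1 => /eqP.
by rewrite -subr_eq0 opprK natr1 pnatr_eq0.
Qed.

Lemma root2_10 : root2 1 0.
Proof. by apply: (@coef_seq_alpha [::] [:: (y1, 0%N)]) => r; rewrite inE => /eqP ->. Qed.

Lemma root2_01 : root2 0 1.
Proof. by apply: (@coef_seq_alpha [:: (y0, 0%N)] [::]) => r; rewrite inE => /eqP ->. Qed.

Lemma root2_a0 a : root2 a 0 -> a = 1%N.
Proof. by move=> a0; apply: (root2_reduced root2_10); rewrite muln1 muln0. Qed.

Lemma root2_0b b : root2 0 b -> b = 1%N.
Proof. by move=> b0; apply: (root2_reduced root2_01); rewrite muln1 muln0. Qed.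

(** Nonnegativity of the reflected coefficients confines the ratio of [b] to [a] to 1 or [N y0 y1]
    when both are positive; reducedness then gives [a = 1]. *)
Lemma root2_typeB a b : (0 < N y0 y1 <= 2)%N -> N y1 y0 = 1%N -> root2 a b ->
  (a, b) \in [:: (1, 0); (0, 1); (1, 1); (1, N y0 y1)]%N.
Proof.
move=> N01 N10 ab.
have r11 : root2 1 1 by have [] := root2_refl0 root2_01 isT; rewrite N10 muln1 subn0.
case: (posnP a) => [a0|a0].
  by move: ab; rewrite a0 => /root2_0b ->.
case: (posnP b) => [b0|b0].
  by move: ab; rewrite b0 => /root2_a0 ->.
have [h1 _] := root2_refl0 ab b0; have [h2 r2] := root2_refl1 ab a0.
rewrite N10 muln1 in h1.
have r12 : root2 1 (N y0 y1) by have [] := root2_refl1 root2_10 isT; rewrite mul1n subn0.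
have [E|E] := posnP (a * N y0 y1 - b)%N.
  have a1 : a = 1%N.
    by apply: (root2_reduced r12); rewrite muln1; have -> : (a * N y0 y1 = b)%N by lia.
  by rewrite !inE !xpair_eqE a1 /=; lia.
have [] := root2_refl0 r2 E; rewrite N10 muln1 => h3 _.
have eab : b = a by move: N01 h2 h3; case: (N y0 y1) => [|[|[|?]]]; lia.
have a1 : a = 1%N by apply: (root2_reduced r11); rewrite !muln1 -{2}eab.
by rewrite eab a1.
Qed.

(** Once the multiples of (1,1), (1,2) and (1,3) are set aside, the inequalities from two successive
    reflections in either order force [a * 3 = b * 2], so that reducedness leaves (2,3). *)
Lemma root2_typeG : N y0 y1 = 3%N -> N y1 y0 = 1%N -> root2 2 3 /\
  forall a b, root2 a b -> (a <= 2)%N /\ (b <= 3)%N.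
Proof.
move=> N01 N10.
have r11 : root2 1 1 by have [] := root2_refl0 root2_01 isT; rewrite N10 muln1 subn0.
have r13 : root2 1 3 by have [] := root2_refl1 root2_10 isT; rewrite mul1n subn0 N01.
have r12 : root2 1 2 by have [] := root2_refl1 r11 isT; rewrite mul1n N01.
have r23 : root2 2 3 by have [] := root2_refl0 r13 isT; rewrite N10.
split=> // a b ab.
case: (posnP a) => [a0|a0]; first by move: ab; rewrite a0 => /root2_0b ->.
case: (posnP b) => [b0|b0]; first by move: ab; rewrite b0 => /root2_a0 ->.
have [h1 r1] := root2_refl0 ab b0; have [h2 r2] := root2_refl1 ab a0.
rewrite N10 muln1 in h1 r1; rewrite N01 in h2 r2.
have red p q : root2 p q -> (a * q = b * p)%N -> (p %| a)%N -> (0 < p)%N -> a = p /\ b = q.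
  move=> pq E /dvdnP[k ak] p0; have bk : b = (k * q)%N.
    by apply/eqP; rewrite -(eqn_pmul2r p0) -E ak mulnAC.
  have k1 : k = 1%N by apply: (root2_reduced pq); rewrite -ak -bk.
  by rewrite ak bk k1 !mul1n.
case: (eqVneq b a) => [E|n11].
  by have [-> ->] := red 1%N 1%N r11 (congr1 (muln^~ 1%N) (esym E)) (dvd1n a) isT.
case: (eqVneq b (a * 3)%N) => [E|n13].
  by have [-> ->] := red 1%N 3%N r13 (etrans (esym E) (esym (muln1 b))) (dvd1n a) isT.
case: (eqVneq b (a * 2)%N) => [E|n12].
  by have [-> ->] := red 1%N 2%N r12 (etrans (esym E) (esym (muln1 b))) (dvd1n a) isT.
have p1 : (0 < a * 3 - b)%N by clear -n13 h2; lia.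
have [h3 r3] := root2_refl0 r2 p1; rewrite N10 muln1 in h3 r3.
have p2 : (0 < b - a)%N by clear -n11 h1; lia.
have [h4 _] := root2_refl1 r1 p2; rewrite N01 in h4.
have p3 : (0 < a * 3 - b - a)%N by clear -n12 h2 h3; lia.
have [h5 _] := root2_refl1 r3 p3; rewrite N01 in h5.
have E : (a * 3 = b * 2)%N by clear -h1 h2 h3 h4 h5; lia.
have ea : (2 %| a)%N by rewrite -(@Gauss_dvdl 2 a 3) // E dvdn_mull.
by have [-> ->] := red 2%N 3%N r23 E ea isT.
Qed.

End RankTwo.

Lemma mult3_cases s t : mult N s t = 3%N ->
  (N s t = 3%N /\ N t s = 1%N) \/ (N t s = 3%N /\ N s t = 1%N).
Proof. by rewrite /mult; case: (N s t) => [|[|[|[|a]]]]; lia. Qed.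

Lemma cartan_norm_typeB y0 y1 (v : 'cV[R]_l) : y0 != y1 -> (forall t, t = y0 \/ t = y1) ->
  (0 < N y0 y1 <= 2)%N -> N y1 y0 = 1%N -> v \in Phi ->
  let B := dotv (alpha y1) (alpha y1) in dotv v v = B \/ dotv v v = 2 * B.
Proof.
move=> y01 cov2 N01 N10 vP B.
have a1 y : alpha y != 0 by apply: (alpha_neq0 Phi_root Pos_pos alpha_simple).
have e0 := cartan_int_dotv (alpha y0) (a1 y1).
have e1 := cartan_int_dotv (alpha y1) (a1 y0).
have y10 : y1 != y0 by rewrite eq_sym.
move: e0 e1; rewrite !(cartan_natE Phi_root Phi_crys Pos_pos alpha_simple).
rewrite (negbTE y01) (negbTE y10) -/N N10 (dotvC (alpha y1) (alpha y0)) -/B => e0 e1.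
have norm a b : dotv (a%:R *: alpha y0 + b%:R *: alpha y1) (a%:R *: alpha y0 + b%:R *: alpha y1)
    = a%:R ^+ 2 * dotv (alpha y0) (alpha y0) + b%:R ^+ 2 * B +
      2 * dotv (alpha y0) (alpha y1) * (a%:R * b%:R).
  rewrite dotvDl !dotvZl ![dotv _ (_ + _)]dotvC !dotvDl !dotvZl.
  by rewrite (dotvC (alpha y1) (alpha y0)) -/B; ring.
have {vP} [w [wP ->]] : exists w, nat_comb alpha w \in Phi /\
    dotv v v = dotv (nat_comb alpha w) (nat_comb alpha w).
  have [w [E|E]] := root_sign Pos_pos alpha_simple vP; exists w; rewrite /nat_comb.
    by rewrite -E.
  have E' : \sum_i (w i)%:R *: alpha i = - v by rewrite E opprK.
  split; last by rewrite E' dotvNl dotvC dotvNl opprK.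
  (* The reflection of [v] in itself shows that [- v] is a root. *)
  have := refl_root Phi_root vP vP; rewrite cartan_intvv ?(root_neq0 Phi_root) // E'.
  by rewrite scaler_nat mulr2n opprD addrA subrr add0r.
rewrite (nat_comb_pair y01 cov2); rewrite (nat_comb_pair y01 cov2) in wP.
have := root2_typeB y01 cov2 N01 N10 wP; rewrite (nat_comb_pairE y01 cov2) norm.
have [N1|N2] : N y0 y1 = 1%N \/ N y0 y1 = 2%N by lia.
- rewrite N1 in e0 * => h; left; move: h; rewrite !inE !xpair_eqE.
  by case/or4P => /andP[/eqP -> /eqP ->]; rewrite ?expr0n ?expr1n /=; lra.
- rewrite N2 in e0 * => h; move: h; rewrite !inE !xpair_eqE.
  case/or4P => /andP[/eqP -> /eqP ->]; rewrite ?expr0n ?expr1n /=.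
  + by right; lra.
  + by left; lra.
  + by left; lra.
  + by right; lra.
Qed.

(** The simple system witnessing type G2 may be unrelated to [alpha]; the length ratio carries over
    because it mentions only roots of [Phi]. *)
Lemma type_G2_norm : is_type_G2 Phi ->
  exists u v : 'cV[R]_l, [/\ u \in Phi, v \in Phi & dotv v v = 3 * dotv u u].
Proof.
move=> [Pos' [alpha' [Pos_pos' simple' [f [g fg gf] fE]]]].
have aP := alpha_Phi Pos_pos' simple'.
exists (alpha' (g 0)), (alpha' (g 1)); split=> //.
have a0 i : alpha' i != 0 by apply: (alpha_neq0 Phi_root Pos_pos' simple').
have := cartan_int_dotv (alpha' (g 0)) (a0 (g 1)).
have := cartan_int_dotv (alpha' (g 1)) (a0 (g 0)).
have := fE (g 0) (g 1); have := fE (g 1) (g 0); rewrite !mxE !gf /= => -> ->.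
by rewrite (dotvC (alpha' (g 1))); lra.
Qed.

Lemma type_G2_card : is_type_G2 Phi -> l = 2%N.
Proof.
move=> [_ [_ [_ _ [f fbij _]]]].
by rewrite -[l]card_ord -[RHS]card_ord; apply: bij_eq_card fbij.
Qed.

Lemma type_G2_mult y0 y1 : y0 != y1 -> (forall t, t = y0 \/ t = y1) ->
  is_type_G2 Phi -> (0 < mult N y0 y1)%N -> ~~ (mult N y0 y1 <= 2)%N.
Proof.
move=> y01 cov2 /type_G2_norm [u [v [uP vP uv]]] m0; apply/negP => m2'.
(* A positive product of at most 2 has a factor 1. *)
wlog N10 : y0 y1 y01 cov2 m0 m2' / N y1 y0 = 1%N => [h|].
  have [|N01] := eqVneq (N y1 y0) 1%N; first exact: (h y0 y1).
  apply: (h y1 y0); rewrite 1?eq_sym 1?multC //.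
    by move=> t; case: (cov2 t); [right|left].
  move: m0 m2' N01; rewrite /mult; case: (N y1 y0) => [|[|[|a]]]; first by rewrite muln0.
  - by [].
  - by lia.
  - by move=> *; nia.
have N01 : (0 < N y0 y1 <= 2)%N by move: m0 m2'; rewrite /mult N10 muln1 => -> ->.
have nrm := cartan_norm_typeB y01 cov2 N01 N10.
have : 0 < dotv (alpha y1) (alpha y1).
  by apply: dotv_gt0; apply: (alpha_neq0 Phi_root Pos_pos alpha_simple).
by move: uv; case: (nrm u uP) => /= ->; case: (nrm v vP) => /= ->; lra.
Qed.

Lemma highest_coef_typeG y0 y1 : y0 != y1 -> (forall t, t = y0 \/ t = y1) ->
  N y0 y1 = 3%N -> N y1 y0 = 1%N -> c_max c = 3%N.
Proof.
move=> y01 cov2 N01 N10; have [r23 rle] := root2_typeG y01 cov2 N01 N10.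
have [cP _] := c_highest; rewrite (nat_comb_pair y01 cov2) in cP.
have [c0 c1] := rle _ _ cP; apply/eqP; rewrite eqn_leq; apply/andP; split.
  by apply/bigmax_leqP => t _; case: (cov2 t) => ->; first exact: leq_trans c0 _.
apply: leq_trans (coef_max y1); apply: (coef_seq_le (r := (y1, 3%N)) r23).
by rewrite !inE eqxx orbT.
Qed.

Lemma second_exponent_typeG n x : induced_path N n x -> covers n x -> n = 2%N ->
  mult N (x 0%N) (x 1%N) = 3%N -> m2 = 5%N.
Proof.
move=> Px cx nE m0; have nl : l = 2%N by rewrite -nE -(card_covers Px cx) card_ord.
have dE z : coxeter_det alpha z = z ^+ 2 - z + 1.
  rewrite (coxeter_det_path z Px cx) nE.
  rewrite (path_minorSS adjC (@pdiag z) (@padj z) (@pmult z) Px) ?nE // m0.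
  by rewrite (path_minor1 (@pdiag z) (@padj z)) path_minor0; ring.
have [h [ord ms mlt pE]] := m_exp.
have rE z : root (char_poly (map_mx (real_complex R) (coxeter_mx alpha))) z =
    (coxeter_det alpha z == 0).
  by rewrite /root (horner_char_poly_coxeter Phi_root Phi_crys Pos_pos alpha_simple).
have rootH z : root (char_poly (map_mx (real_complex R) (coxeter_mx alpha))) z -> z ^+ 6 = 1.
  rewrite rE => /eqP; apply: (@pow_eq1_of_factor _ _ ((z ^+ 3 - 1) * (z + 1))).
  by rewrite dE; ring.
have rootw j : (j == 1%N) || (j == 5%N) ->
    root (char_poly (map_mx (real_complex R) (coxeter_mx alpha)))
      (expi (2 * pi * j%:R / 6%:R)).
  move=> jk; rewrite rE; set w := expi _; apply/eqP.
  have wH a : (w ^+ a == 1) = (6 %| j * a)%N by rewrite expi_fracX expi_frac_eq1.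
  have h1 : w ^+ 1 + 1 != 0 by apply: (neq_powN1 wH); case/orP: jk => /eqP ->.
  have h3 : w ^+ 3 = -1 by apply: (pow_eqN1 wH); case/orP: jk => /eqP ->.
  apply: (mulfI h1); rewrite mulr0 dE.
  transitivity (w ^+ 3 + 1); first by ring.
  by rewrite h3 addNr.
have hle := coxeter_order_le ord pE (isT : (0 < 6)%N) rootH.
have [i Ei _] := exponent_of_root ord mlt pE (isT : (0 < 6)%N) rootH
  (isT : (1 < 6)%N) (rootw 1%N isT).
have [j Ej _] := exponent_of_root ord mlt pE (isT : (0 < 6)%N) rootH
  (isT : (5 < 6)%N) (rootw 5%N isT).
have /andP[mi _] := mlt i.
(* The eigenvalue exp(2 i pi / 6) makes [h] a positive multiple of 6, so the order is known exactly
   here. *)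
have h6 : h = 6%N by clear -hle Ei mi; lia.
rewrite h6 in Ei Ej; have {}Ei : tnth m i = 1%N by clear -Ei; lia.
have {}Ej : tnth m j = 5%N by clear -Ej; lia.
have mono : (nth 0 m 0 <= nth 0 m 1)%N.
  by apply: (sorted_leq_nth leq_trans leqnn) => //; rewrite inE size_tuple // ltnW.
rewrite /m2; move: Ei Ej; rewrite !(tnth_nth 0%N) /=.
have := leq_trans (ltn_ord i) (eq_leq nl); have := leq_trans (ltn_ord j) (eq_leq nl).
move: (nat_of_ord i) (nat_of_ord j) mono => [|[|?]] [|[|?]] // mono _ _.
- by move=> ->.
- by move=> E1 E5; move: mono; rewrite E1 E5.
Qed.

Lemma type_G2_of_cartan y0 y1 : y0 != y1 -> (forall t, t = y0 \/ t = y1) ->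
  N y1 y0 = 3%N -> N y0 y1 = 1%N -> is_type_G2 Phi.
Proof.
move=> y01 cov2 N10 N01; have y10 : y1 != y0 by rewrite eq_sym.
exists Pos, alpha; split=> //.
exists (fun t => if t == y0 then 0 else 1).
  exists (fun i => if i == 0 then y0 else y1) => [t|[[|[|i]] ?]] //=.
  - by case: (cov2 t) => ->; rewrite ?eqxx ?(negbTE y10).
  - by rewrite eqxx; apply: val_inj.
  - by rewrite (negbTE y10); apply: val_inj.
move=> s t; rewrite !mxE (cartan_natE Phi_root Phi_crys Pos_pos alpha_simple).
by case: (cov2 s) => ->; case: (cov2 t) => ->;
  rewrite ?eqxx ?(negbTE y10) ?(negbTE y01) //= -/N ?N10 ?N01.
Qed.

Lemma second_exponent_dichotomy :
  (is_type_G2 Phi /\ c_max c = 3%N /\ m2 = 5%N) \/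
  (~ is_type_G2 Phi /\ (m2 <= (c_max c).+1)%N).
Proof.
have noG2 : l <> 2%N -> ~ is_type_G2 Phi by move=> l2 /type_G2_card.
have cpos t := highest_root_gt0 Pos_pos alpha_simple c_highest t.
case: cartan_nat_shape => [n x Px cx n1 mE|n x v i Px vx cov vadj mv m1 i1 iE]; last first.
  right; split.
    by apply: noG2; rewrite -[l]card_ord (card_branch Px vx cov); lia.
  case: iE => [iE|[iE n48]].
    exact: (second_exponent_typeD Px vx cov vadj mv m1 i1 iE).
  exact: (second_exponent_typeE Px vx cov vadj mv m1 i1 iE n48).
have nl : n = l by rewrite -(card_covers Px cx) card_ord.
have x01 : x 0%N != x 1%N by case: Px => inj _ _; apply/eqP => /(inj _ _ (ltnW n1) n1).
have cov2 : n = 2%N -> forall t, t = x 0%N \/ t = x 1%N.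
  by move=> n2 t; case: (cx t) => j; rewrite n2; case: j => [|[|]] // _ ->; [left|right].
have rank2 : (mult N (x 0%N) (x 1%N) <= 2)%N -> ~ is_type_G2 Phi.
  move=> m012; have [n2 G2|n2] := eqVneq n 2%N; last by apply: noG2; rewrite -nl; apply/eqP.
  have := type_G2_mult x01 (cov2 n2) G2 (mult_path adjC Px n1).
  by rewrite m012.
case: mE => [m1|[n2 m3]|[m20 m1]|[n4 [m0 m1 m3]]].
- right; split; first by apply: rank2; rewrite m1.
  apply: leq_trans (second_exponent_typeA Px cx m1) _; rewrite ltnS.
  exact: leq_trans (cpos (x 0%N)) (coef_max _).
- left; split; last split.
  + case: (mult3_cases m3) => -[Na Nb].
      by apply: (@type_G2_of_cartan (x 1%N) (x 0%N)); rewrite 1?eq_sym // => t;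
        case: (cov2 n2 t); [right|left].
    exact: (@type_G2_of_cartan (x 0%N) (x 1%N) x01 (cov2 n2)).
  + case: (mult3_cases m3) => -[Na Nb].
      exact: (@highest_coef_typeG (x 0%N) (x 1%N) x01 (cov2 n2)).
    by apply: (@highest_coef_typeG (x 1%N) (x 0%N)); rewrite 1?eq_sym // => t;
      case: (cov2 n2 t); [right|left].
  + exact: (second_exponent_typeG Px cx n2 m3).
- right; split; first by apply: rank2; rewrite m20.
  exact: (second_exponent_typeB Px cx n1 m20 m1).
- right; split; first by apply: rank2; rewrite m0.
  exact: (second_exponent_typeF Px cx n4 m0 m1 m3).
Qed.

End SecondExponent.

Theorem corollary1p2 (R : realType) (l : nat) (l_ge2 : (2 <= l)%N)
    (Phi : {fset 'cV[R]_l})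
    (Phi_root : is_root_system Phi)
    (Phi_crys : crystallographic Phi)
    (Phi_irr : irreducible_roots Phi)
    (Pos : {fset 'cV[R]_l}) (Pos_pos : is_positive_system Phi Pos)
    (alpha : 'I_l -> 'cV[R]_l) (alpha_simple : is_simple_system Pos alpha)
    (c : 'I_l -> nat)
    (c_highest : is_highest_root Phi alpha
                   (\sum_(i < l) (c i)%:R *: alpha i))
    (m : l.-tuple nat) (m_exp : is_exponents alpha m) :
  is_type_G2 Phi <-> (c_max c)%:Z = (tnth m (Ordinal l_ge2))%:Z - 2.
Proof.
have [[G2 [-> ->]]|[nG2 m2]] := second_exponent_dichotomy l_ge2 Phi_root Phi_crys
  Pos_pos alpha_simple c_highest m_exp; first by split.
by split=> [/nG2//|]; lia.
Qed.
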